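(* There is an absolute constant $C>0$ such that the following holds. Let $V$ be a finite set with $n=|V|\ge 2$ and let $\mathcal{P}=(P_t)_{t\ge 1}$ be a sequence of irreducible, reversible and lazy transition matrices on $V$ which all have the same stationary distribution $\pi$. Then $$t_{\mathrm{coal}}(\mathcal{P})\le C\,t_{\mathrm{HIT}}(\mathcal{P}).$$
   Context: A transition matrix $P\in[0,1]^{V\times V}$ is a row-stochastic matrix. It is irreducible if for all $u,v$ there is $t>0$ with $P^t(u,v)>0$; lazy if $P(v,v)\ge 1/2$ for all $v$; reversible if $\pi(u)P(u,v)=\pi(v)P(v,u)$ for all $u,v$, where $\pi$ is its stationary distribution. $t_{\mathrm{hit}}(P)=\max_{u,w\in V}\mathbf{E}[\min\{t\ge 0:X_t=w\}\mid X_0=u]$ for the time-homogeneous chain $(X_t)$ with transition matrix $P$; $t_{\mathrm{HIT}}(\mathcal{P})=\max_{t\ge 1}t_{\mathrm{hit}}(P_t)$ (read as a supremum, assumed finite). Coalescing random walks according to $\mathcal{P}$: $n$ walkers with positions $\mathrm{C}_t=(\mathrm{C}_t(1),\dots,\mathrm{C}_t(n))\in V^n$, started at $\mathrm{C}_0\in V^n$. At step $t\ge1$, for $a=1,\dots,n$ in order: if there is $b<a$ with $\mathrm{C}_{t-1}(a)=\mathrm{C}_{t-1}(b)$, then $\mathrm{C}_t(a)=\mathrm{C}_t(b)$; otherwise $\mathrm{C}_t(a)$ is sampled (independently of the others) from $P_t(\mathrm{C}_{t-1}(a),\cdot)$. Let $\tau_{\mathrm{coal}}(\mathcal{P})=\min\{t\ge0:|\{\mathrm{C}_t(1),\dots,\mathrm{C}_t(n)\}|=1\}$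 and $t_{\mathrm{coal}}(\mathcal{P})=\max_{x\in V^n}\mathbf{E}[\tau_{\mathrm{coal}}(\mathcal{P})\mid\mathrm{C}_0=x]$. *)

(* Defs.v *)
From HB Require Import structures.
From mathcomp Require Import all_boot all_order all_algebra.
From mathcomp Require Import all_classical all_reals all_analysis.
From mathcomp Require Import measurable_realfun.
From mathcomp Require Import ring lra.

Set Implicit Arguments.
Unset Strict Implicit.
Unset Printing Implicit Defensive.

Import Order.TTheory GRing.Theory Num.Theory.
Import numFieldNormedType.Exports.

Local Open Scope classical_set_scope.
Local Open Scope ring_scope.

Section transition_matrices.
Context (R : realType) (V : finType).
Implicit Types (P : V -> V -> R) (pi : V -> R).

Definition transition_matrix P : Prop :=
  (forall u v, 0 <= P u v <= 1) /\ (forall u, \sum_v P u v = 1).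

Definition mx_of P : 'M[R]_#|V| := \matrix_(i, j) P (enum_val i) (enum_val j).

Definition irreducible P : Prop :=
  forall u v, exists2 t : nat, (0 < t)%N &
    0 < (mx_of P ^+ t) (enum_rank u) (enum_rank v).

Definition lazy P : Prop := forall v, 1 / 2 <= P v v.

Definition stationary_distribution P pi : Prop :=
  [/\ forall v, 0 <= pi v, \sum_v pi v = 1 &
      forall v, \sum_u pi u * P u v = pi v].

Definition reversible P pi : Prop :=
  forall u v, pi u * P u v = pi v * P v u.

End transition_matrices.

Section markov_chains.
Context (R : realType) (S : finType).
Implicit Types (K : nat -> S -> S -> R) (x : S) (A : pred S).

(* Time-inhomogeneous Markov chain started at x: the matrix [K t] governs the
   step from time t-1 to time t, so that [K 0] plays no role. *)
Definition is_markov_chain K x d (T : measurableType d) (Pr : probability T R)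
    (X : nat -> T -> S) : Prop :=
  (forall t s, measurable [set w | X t w = s]) /\
  (forall t (p : nat -> S),
     Pr [set w | forall i, (i <= t)%N -> X i w = p i] =
     ((x == p 0%N)%:R * \prod_(i < t) K i.+1 (p i) (p i.+1))%:E).

(* min {t >= 0 : y t \in A}, equal to +oo if y never visits A *)
Definition hit_time A (y : nat -> S) : \bar R :=
  ereal_inf [set t%:R%:E | t in [set t : nat | A (y t)]].

(* E[hit_time A | X_0 = x]. Every realization of the chain gives the same value
   [expected_hit_timeE], and each stochastic K has a realization
   [markov_chain_exists], so the supremum is over a singleton. *)
Definition expected_hit_time K x A : \bar R :=
  ereal_sup [set e | exists d (T : measurableType d) (Pr : probability T R)
      (X : nat -> T -> S),
    is_markov_chain K x Pr X /\ e = (\int[Pr]_w hit_time A (X ^~ w))%E].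

End markov_chains.

Section law_of_hitting_times.
Context (R : realType) (S : finType).
Implicit Types (K : nat -> S -> S -> R) (x : S) (A : pred S).

Definition avoids A t (y : nat -> S) := [forall i : 'I_t.+1, ~~ A (y i)].

Lemma avoids_indic A t d (T : measurableType d) (X : nat -> T -> S) w :
  (avoids A t (X ^~ w))%:R = \1_[set w | avoids A t (X ^~ w)] w :> R.
Proof.
rewrite indicE; congr ((nat_of_bool _)%:R); apply/esym; apply/idP/idP => /=; first by rewrite inE.
by move=> H; rewrite inE.
Qed.

Lemma hit_time_series A (y : nat -> S) :
  hit_time R A y = (\sum_(0 <= t <oo) (avoids A t y)%:R%:E)%E.
Proof.
have [[t At]|nA] := pselect (exists t, A (y t)).
  have exA : exists t, A (y t) by exists t.
  pose m := ex_minn exA.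
  have [Am mmin] : A (y m) /\ forall n, A (y n) -> (m <= n)%N.
    by rewrite /m; case: ex_minnP.
  have avE n : avoids A n y = (n < m)%N.
    apply/forallP/idP => [H|nm i].
      rewrite ltnNge; apply/negP => mn.
      by have := H (inord m); rewrite inordK ?ltnS// Am.
    apply/negP => /mmin; rewrite leqNgt => /negP; apply.
    by apply: leq_ltn_trans nm; rewrite -ltnS.
  rewrite (nneseries_split _ m)//.
  rewrite eseries0 ?adde0; last first.
    by move=> i; rewrite add0n => mi _; rewrite avE ltnNge mi.
  rewrite add0n big_nat (eq_bigr (fun=> 1%E)); last by move=> i /andP[_ im]; rewrite avE im.
  rewrite -big_nat big_mkord sumEFin sumr_const card_ord.
  apply/eqP; rewrite eq_le; apply/andP; split.
    by apply: ereal_inf_lbound; exists m.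
  apply: le_ereal_inf_tmp => _ [n An <-]; rewrite lee_fin ler_nat; exact: mmin.
have -> : hit_time R A y = +oo%E.
  rewrite /hit_time -ereal_inf0; congr ereal_inf.
  by apply/seteqP; split => // z [n An _]; apply: nA; exists n.
apply/esym/eq_infty => r.
apply: le_trans (nneseries_lim_ge (m := 0) (Num.truncn `|r|).+1 _); last first.
  by move=> n _ _; rewrite lee_fin ler0n.
rewrite (eq_bigr (fun=> 1%E)); last first.
  move=> n _; rewrite (_ : avoids A n y)//.
  by apply/forallP => i; apply/negP => Ai; apply: nA; exists i.
rewrite big_mkord sumEFin sumr_const card_ord lee_fin.
apply: (le_trans (ler_norm r)); apply: ltW.
exact: truncnS_gt.
Qed.

(* P(X_0, ..., X_t not in A) *)
Definition avoid_prob K x A t : R :=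
  \sum_(p : {ffun 'I_t.+1 -> S} | [forall i, ~~ A (p i)])
    ((x == p ord0)%:R *
     \prod_(i < t) K i.+1 (p (inord i)) (p (inord i.+1))).

Context d (T : measurableType d) (Pr : probability T R).
Context K x (X : nat -> T -> S) (mcX : is_markov_chain K x Pr X).

Let cyl t (p : {ffun 'I_t.+1 -> S}) :=
  [set w | forall i, (i <= t)%N -> X i w = p (inord i)].

Let mcyl t p : measurable (@cyl t p).
Proof.
rewrite (_ : cyl p = \bigcap_(i in [set i | (i < t.+1)%N]) [set w | X i w = p (inord i)])//.
by apply: bigcap_measurable => [|k _]; [exists 0%N | exact: mcX.1].
Qed.

Lemma prob_avoids A t :
  measurable [set w | avoids A t (X ^~ w)] /\
  Pr [set w | avoids A t (X ^~ w)] = (avoid_prob K x A t)%:E.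
Proof.
pose D := [set` [pred p : {ffun 'I_t.+1 -> S} | [forall i, ~~ A (p i)]]].
have E : [set w | avoids A t (X ^~ w)] = \bigcup_(p in D) cyl p.
  apply/seteqP; split => w /=.
    move=> /forallP H; exists [ffun i : 'I_t.+1 => X i w].
      by apply/forallP => i; rewrite ffunE.
    by move=> i it; rewrite ffunE inordK.
  move=> [p /forallP pD wp]; apply/forallP => i.
  by rewrite wp ?inord_val// -ltnS.
have fD : finite_set D by exact: finite_finset.
split; first by rewrite E; apply: fin_bigcup_measurable.
rewrite E measure_fin_bigcup//; last first.
  apply/trivIsetP => p q _ _ pq; apply/seteqP; split => // w [wp wq].
  move/eqP: pq; apply; apply/ffunP => i.
  have it : (i <= t)%N by rewrite -ltnS.
  by have := wp _ it; rewrite (wq _ it) inord_val.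
rewrite -(@bigfs _ _ _ _ (index_enum _)) ?index_enum_uniq//; last by move=> p _; rewrite mem_index_enum.
rewrite /avoid_prob -sumEFin; apply: eq_bigr => p _.
rewrite [LHS](mcX.2 t (fun i => p (inord i))); do 2 f_equal.
by congr (_ == p _)%:R; apply/val_inj; rewrite /= inordK.
Qed.

Lemma integral_hit_time A :
  (\int[Pr]_w hit_time R A (X ^~ w) =
   \sum_(0 <= t <oo) (avoid_prob K x A t)%:E)%E.
Proof.
under eq_integral do rewrite hit_time_series.
rewrite integral_nneseries//; last first.
  move=> t; apply/measurable_EFinP.
  rewrite (_ : (fun w => _) = \1_[set w | avoids A t (X ^~ w)]).
    by apply: measurable_indic; exact: (prob_avoids A t).1.
  by apply/funext => w; rewrite avoids_indic.
apply: eq_eseriesr => t _; have [mA <-] := prob_avoids A t.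
rewrite -[X in Pr X]setIT -integral_indic//; apply: eq_integral => w _.
by rewrite avoids_indic.
Qed.

End law_of_hitting_times.

Lemma expected_hit_timeE (R : realType) (S : finType) (K : nat -> S -> S -> R)
    (x : S) (A : pred S) d (T : measurableType d) (Pr : probability T R)
    (X : nat -> T -> S) :
  is_markov_chain K x Pr X ->
  expected_hit_time K x A = (\int[Pr]_w hit_time R A (X ^~ w))%E.
Proof.
move=> mcX; rewrite -[RHS]ereal_sup1; congr ereal_sup.
apply/seteqP; split => e /=; last by move=> ->; exists d, T, Pr, X.
move=> [d' [T' [Pr' [X' [mcX' ->]]]]].
by rewrite (integral_hit_time mcX) (integral_hit_time mcX').
Qed.

Section existence.
Context (R : realType).

Lemma measurable_unit : measurable (`[0, 1[ : set (measurableTypeR R)).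
Proof. exact: measurable_itv. Qed.

Definition unit_prob := mrestr (@lebesgue_measure R) measurable_unit.

HB.instance Definition _ := Measure.on unit_prob.

Lemma unit_probT : unit_prob setT = 1%E.
Proof.
by rewrite /unit_prob /mrestr setTI lebesgue_measure_itv/= lte_fin ltr01 oppr0 adde0.
Qed.

HB.instance Definition _ := @Measure_isProbability.Build _ _ R unit_prob unit_probT.

Context (S : finType).

Section select.
Variable f : S -> R.
Hypotheses (f0 : forall s, 0 <= f s) (f1 : \sum_s f s = 1).

Definition cumul k : R := \sum_(r | (enum_rank r < k)%N) f r.

(* inverse transform sampling of the distribution f *)
Definition select s0 (u : R) : S :=
  odflt s0 [pick s | cumul (enum_rank s) <= u < cumul (enum_rank s).+1].

Lemma cumulS s : cumul (enum_rank s).+1 = cumul (enum_rank s) + f s.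
Proof.
rewrite /cumul (bigD1 s)//= addrC; congr (_ + _); apply: eq_bigl => r.
rewrite ltnS ltn_neqAle andbC; congr (_ && _).
by rewrite -(inj_eq enum_rank_inj).
Qed.

Lemma le_cumul : {homo cumul : m n / (m <= n)%N >-> m <= n}.
Proof.
move=> m n mn; rewrite /cumul [leRHS](bigID (fun r => (enum_rank r < m)%N))/=.
rewrite -[leLHS]addr0 lerD ?sumr_ge0// le_eqVlt; apply/orP; left; apply/eqP.
apply: eq_bigl => r; case: ltnP => rm; rewrite ?andbF ?andbT//.
by rewrite (leq_trans rm mn).
Qed.

Lemma cumul0 : cumul 0 = 0. Proof. by rewrite /cumul big_pred0. Qed.

Lemma cumul1 : cumul #|S| = 1.
Proof. by rewrite -f1; apply: eq_bigl => r; rewrite ltn_ord. Qed.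

Lemma selectP s0 u s : 0 <= u < 1 ->
  select s0 u = s <-> cumul (enum_rank s) <= u < cumul (enum_rank s).+1.
Proof.
move=> /andP[u0 u1].
have uniq_s r r' : cumul (enum_rank r) <= u < cumul (enum_rank r).+1 ->
    cumul (enum_rank r') <= u < cumul (enum_rank r').+1 ->
    (enum_rank r' <= enum_rank r)%N.
  move=> /andP[_ ur] /andP[ur' _]; rewrite leqNgt; apply/negP => /le_cumul.
  by rewrite leNgt (le_lt_trans ur' ur).
rewrite /select; case: pickP => [r ur|nou] /=; last first.
  exfalso; suff : cumul #|S| <= u by rewrite cumul1 leNgt u1.
  suff H k : (k <= #|S|)%N -> cumul k <= u by exact: H.
  elim: k => [|k IH kS]; first by rewrite cumul0.
  have := nou (enum_val (Ordinal kS)); rewrite enum_valK /= IH 1?ltnW//=.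
  by move=> /negbT; rewrite -leNgt.
split => [<-//|us]; apply/enum_rank_inj/val_inj/eqP.
by rewrite eqn_leq !uniq_s.
Qed.

End select.

Variables (K : nat -> S -> S -> R) (x : S).

Fixpoint sample_chain (t : nat) (u : R) : S * R :=
  if t is t'.+1 then
    let: (s, v) := sample_chain t' u in
    let s' := select (K t s) s v in
    (s', (v - cumul (K t s) (enum_rank s')) / K t s s')
  else (x, u).

Definition sample_path (t : nat) (u : measurableTypeR R) : S :=
  if 0 <= u < 1 then (sample_chain t u).1 else x.

Hypothesis K0 : forall t s s', (0 < t)%N -> 0 <= K t s s'.
Hypothesis K1 : forall t s, (0 < t)%N -> \sum_s' K t s s' = 1.

Lemma sample_chain_cylinder t (p : nat -> S) :
  let W := (x == p 0%N)%:R * \prod_(i < t) K i.+1 (p i) (p i.+1) in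
  0 <= W /\ exists l : R, [/\ 0 <= l, l + W <= 1 & forall u : R, 0 <= u < 1 ->
    ((forall i, (i <= t)%N -> (sample_chain i u).1 = p i) <-> l <= u < l + W) /\
    (l <= u < l + W -> (sample_chain t u).2 = (u - l) / W)].
Proof.
elim: t => [|t [W0 [l [l0 lW IH]]]] W.
  rewrite /W big_ord0 mulr1; split; first exact: ler0n.
  exists 0; rewrite lexx add0r lern1 leq_b1; split => // u u01; split; last first.
    by case: eqP => /=; rewrite ?subr0 ?divr1//; case/andP: u01 => ? ?; lra.
  split => [/(_ 0%N isT) /= <-|]; first by rewrite eqxx.
  case: eqP => [xp _ i|_]; first by rewrite leqn0 => /eqP ->.
  by rewrite /= mulr0n => /andP[a b]; have := le_lt_trans a b; rewrite ltxx.
set W_ := (X in 0 <= X) in W0 lW IH.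
set k := K t.+1 (p t) (p t.+1).
have WE : W = W_ * k by rewrite /W big_ord_recr /= mulrA.
have k0 : 0 <= k by exact: K0.
set f := K t.+1 (p t).
have f0 s : 0 <= f s by exact: K0.
have f1 : \sum_s f s = 1 by exact: K1.
set c := cumul f (enum_rank (p t.+1)).
have c0 : 0 <= c by apply: sumr_ge0.
have cS : cumul f (enum_rank (p t.+1)).+1 = c + k by exact: cumulS.
have ck : c + k <= 1.
  by rewrite -cS -(cumul1 f1); apply: le_cumul => //; exact: ltn_ord.
rewrite {}WE; split; first exact: mulr_ge0.
have lck : l + W_ * (c + k) <= l + W_ by rewrite lerD2l ler_piMr.
exists (l + W_ * c); split.
- by rewrite addr_ge0// mulr_ge0.
- by rewrite -addrA -mulrDr (le_trans lck).
move=> u u01; have [IHiff IHres] := IH u u01.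
have sub : l + W_ * c <= u < l + W_ * c + W_ * k -> l <= u < l + W_.
  move=> /andP[a b]; apply/andP; split.
    by apply: le_trans a; rewrite lerDl mulr_ge0.
  by apply: lt_le_trans b _; rewrite -addrA -mulrDr.
have key : l <= u < l + W_ ->
    (sample_chain t.+1 u).1 = p t.+1 <-> l + W_ * c <= u < l + W_ * c + W_ * k.
  move=> lu; have pt := IHiff.2 lu t (leqnn t); have rt := IHres lu.
  have Wp : 0 < W_ by case/andP: lu => ? ?; lra.
  have v01 : 0 <= (u - l) / W_ < 1.
    by rewrite ler_pdivlMr// ltr_pdivrMr//; case/andP: lu => ? ?; lra.
  rewrite /=; case: (sample_chain t u) pt rt => s v /= -> ->.
  apply: (iff_trans (selectP f0 f1 _ _ v01)); rewrite -/c cS.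
  by rewrite ler_pdivlMr// ltr_pdivrMr//; split => /andP[? ?]; apply/andP; split; lra.
split.
  split => [H|H].
    apply: (key _).1; last exact: H.
    by apply: IHiff.1 => i it; apply: H; exact: leqW.
  move=> i; rewrite leq_eqVlt => /predU1P[->|it]; first exact: (key (sub H)).2.
  exact: IHiff.2 (sub H) i it.
move=> H; have lu := sub H.
have pS := (key lu).2 H.
have Wp : 0 < W_ by case/andP: lu => ? ?; lra.
have Wk : 0 < W_ * k by case/andP: H => ? ?; lra.
have kp : 0 < k by rewrite pmulr_rgt0 in Wk.
have pt := IHiff.2 lu t (leqnn t); have rt := IHres lu.
move: pS => /=; case: (sample_chain t u) pt rt => s v /= -> -> ->.
rewrite -/f -/c -/W_ -[f _]/k.
by field; rewrite !gt_eqF.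
Qed.

Lemma sample_path_cylinder t (p : nat -> S) :
  measurable [set u | forall i, (i <= t)%N -> sample_path i u = p i] /\
  unit_prob [set u | forall i, (i <= t)%N -> sample_path i u = p i] =
  ((x == p 0%N)%:R * \prod_(i < t) K i.+1 (p i) (p i.+1))%:E.
Proof.
have [] := sample_chain_cylinder t p; set W := (X in 0 <= X).
move=> W0 [l [l0 lW H]]; rewrite -/W in lW H *; set A := [set u | _].
pose U : set (measurableTypeR R) := `[0, 1[%classic.
have AI : A `&` U = `[l, l + W[%classic.
  apply/seteqP; split => u; rewrite /U /= !in_itv/=.
    move=> [Au u01]; apply: (H u u01).1.1 => i it.
    by have := Au i it; rewrite /sample_path u01.
  move=> lu; have u01 : 0 <= u < 1 by case/andP: lu => ? ?; lra.
  by split=> // i it; rewrite /sample_path u01; exact: (H u u01).1.2 lu i it.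
have mA' : measurable (A `&` ~` U).
  have [px|px] := pselect (forall i, (i <= t)%N -> x = p i).
    rewrite (_ : _ `&` _ = ~` U); first by apply: measurableC; exact: measurable_unit.
    apply/seteqP; split => u; rewrite /U /= in_itv/=; first by case.
    move=> /negP u01.
    by split=> [i it|]; [rewrite /sample_path (negbTE u01) (px i)|exact/negP].
  rewrite (_ : _ `&` _ = set0)//; apply/seteqP; split => u //= [Au].
  rewrite /U /= in_itv/= => /negP u01; apply: px => i it.
  by have := Au i it; rewrite /sample_path (negbTE u01).
split.
  rewrite -(setUIDK A U) setDE AI; apply: measurableU => //.
rewrite /unit_prob /mrestr [X in lebesgue_measure X]AI lebesgue_measure_itv/= lte_fin.
case: ltP => lWl; first by rewrite -EFinB addrC addKr.
by congr EFin; apply/eqP; rewrite eq_le W0; lra.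
Qed.

Lemma markov_chain_exists : exists d (T : measurableType d) (Pr : probability T R)
  (X : nat -> T -> S), is_markov_chain K x Pr X.
Proof.
exists _, _, unit_prob, sample_path; split => [t s|t p]; last first.
  exact: (sample_path_cylinder t p).2.
rewrite (_ : [set w | _] = \bigcup_(p in [set` [pred p : {ffun 'I_t.+1 -> S} | p ord_max == s]])
   [set u | forall i, (i <= t)%N -> sample_path i u = p (inord i)]).
  apply: fin_bigcup_measurable => [|p _]; first exact: finite_finset.
  exact: (sample_path_cylinder t (fun i => p (inord i))).1.
apply/seteqP; split => u /=.
  move=> us; exists [ffun i : 'I_t.+1 => sample_path i u] => /=.
    by rewrite inE/= ffunE us.
  by move=> i it; rewrite ffunE inordK.
move=> [p /= /eqP ps /(_ t (leqnn t)) ->]; rewrite -ps; congr (p _).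
by apply/val_inj; rewrite /= inordK.
Qed.

End existence.

Section hitting_and_coalescence.
Context (R : realType) (V : finType).
Implicit Types (P : V -> V -> R) (PP : nat -> V -> V -> R).

Definition t_hit P : \bar R :=
  \big[maxe/-oo%E]_(u : V) \big[maxe/-oo%E]_(w : V)
    expected_hit_time (fun=> P) u (pred1 w).

Definition t_HIT PP : \bar R :=
  ereal_sup [set t_hit (PP t) | t in [set t : nat | (1 <= t)%N]].

Definition positions := {ffun 'I_#|V| -> V}.

(* One step of coalescing random walks: a walker sharing its vertex with a
   walker of smaller index copies the move of that walker; the other walkers
   move independently according to P. *)
Definition coal_step P (c c' : positions) : R :=
  \prod_(a < #|V|)
    (if [exists b : 'I_#|V|, (b < a)%N && (c b == c a)]
     then [forall b : 'I_#|V|, ((b < a)%N && (c b == c a)) ==> (c' a == c' b)]%:R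
     else P (c a) (c' a)).

Definition coalesced : pred positions := fun c => #|codom c| == 1%N.

Definition t_coal PP : \bar R :=
  \big[maxe/-oo%E]_(x : positions)
    expected_hit_time (fun t => coal_step (PP t)) x coalesced.

End hitting_and_coalescence.

(* Main.v *)
(* Let N be an integer with t_HIT <= N <= 2 t_HIT, so that #|V| <= N, and let
   lambda = 1 - 1/N. By the Schur test applied to the expected hitting time of w,
   <f, P_t f> <= lambda <f, f> in L^2(pi) whenever f w = 0. Laziness makes P_t
   positive semidefinite, so a Cauchy-Schwarz argument turns this into the
   meeting time lemma: a stationary walk avoids a given trajectory for s steps
   with probability at most lambda^s. Applied to the trajectory of a second walk,
   it bounds the total variation mixing time by O(N), and, splitting time into two
   halves and using reversibility, it yields P_1 ... P_T >= (8/9) pi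
   entrywise for some T = O(N).

   The coalescing walks are dominated by independent walkers 0, ..., n-1 among
   which only certain killings are performed: during epoch j, of length about
   6 N (j+1) / 2^j, a walker a in [2^j, 2^(j+1)) dies when it meets some walker
   b < 2^j. The epochs are run for decreasing j after a mixing period T, so that
   in epoch j the 2^j killers are still alive and independent; hence a survives
   with probability at most 8^-(j+1) <= (a+1)^-3. A union bound shows that all
   the walks have coalesced after O(N) steps with probability at least 1/2,
   whatever the initial time and positions. *)

Require Import Defs.
From HB Require Import structures.
From mathcomp Require Import all_boot all_order all_algebra.
From mathcomp Require Import all_classical all_reals all_analysis.
From mathcomp Require Import ring lra zify.

Set Implicit Arguments.
Unset Strict Implicit.
Unset Printing Implicit Defensive.

Import Order.TTheory GRing.Theory Num.Theory.

Local Open Scope ring_scope.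

(** * Contraction of killed reversible kernels *)

Section kernels.
Context (R : realType) (V : finType).
Implicit Types (M : V -> V -> R) (f g : V -> R).

Definition act M f u := \sum_v M u v * f v.

Definition stochastic M := (forall u v, 0 <= M u v) /\ (forall u, \sum_v M u v = 1).

Lemma act_ge0 M f u : stochastic M -> (forall v, 0 <= f v) -> 0 <= act M f u.
Proof. by move=> [M0 _] f0; apply: sumr_ge0 => v _; apply: mulr_ge0. Qed.

Lemma act_cst M c u : stochastic M -> act M (fun=> c) u = c.
Proof. by move=> [_ M1]; rewrite /act -mulr_suml M1 mul1r. Qed.

Lemma act_le M f g u : stochastic M -> (forall v, f v <= g v) -> act M f u <= act M g u.
Proof. by move=> [M0 _] fg; apply: ler_sum => v _; apply: ler_wpM2l. Qed.

Lemma act_le1 M f u : stochastic M -> (forall v, f v <= 1) -> act M f u <= 1.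
Proof. by move=> M1 f1; rewrite -[leRHS](act_cst 1 u M1); apply: act_le. Qed.

Variable pi : V -> R.
Hypothesis pi0 : forall v, 0 <= pi v.

Definition dot f g := \sum_u pi u * (f u * g u).

Lemma dot_act_sym M f g : reversible M pi -> dot f (act M g) = dot (act M f) g.
Proof.
move=> revM; rewrite /dot.
transitivity (\sum_u \sum_v pi u * M u v * (f u * g v)).
  by apply: eq_bigr => u _; rewrite !mulr_sumr; apply: eq_bigr => v _; ring.
rewrite exchange_big; apply: eq_bigr => v _ /=.
rewrite mulr_suml mulr_sumr; apply: eq_bigr => u _.
by rewrite revM; ring.
Qed.

Lemma pi_act M f : stochastic M -> reversible M pi ->
  \sum_u pi u * act M f u = \sum_u pi u * f u.
Proof.
move=> M1 revM; have := dot_act_sym (fun=> 1) f revM; rewrite /dot.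
under eq_bigr do rewrite mul1r.
by move=> ->; apply: eq_bigr => u _; rewrite act_cst// mul1r.
Qed.

(** Twice the form equals the sum of [pi u * (M u v - (u == v)%:R / 2) * (f u + f v) ^+ 2], and
    laziness makes the diagonal weights nonnegative. *)
Lemma lazy_psd M f : stochastic M -> reversible M pi -> lazy M -> 0 <= dot f (act M f).
Proof.
move=> [M0 M1] revM lazyM.
have B : \sum_u \sum_v pi u * M u v * (f u * f v) = dot f (act M f).
  by apply: eq_bigr => u _; rewrite !mulr_sumr; apply: eq_bigr => v _; ring.
have Du : \sum_u \sum_v pi u * M u v * f u ^+ 2 = dot f f.
  by apply: eq_bigr => u _; rewrite -mulr_suml -mulr_sumr M1 mulr1 expr2.
have Dv : \sum_u \sum_v pi u * M u v * f v ^+ 2 = dot f f.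
  rewrite -Du exchange_big; apply: eq_bigr => v _ /=.
  by apply: eq_bigr => u _; rewrite revM.
have Ddiag : \sum_u \sum_v pi u * ((u == v)%:R / 2) * (f u + f v) ^+ 2 = 2 * dot f f.
  rewrite /dot mulr_sumr; apply: eq_bigr => u _.
  rewrite (bigD1 u)//= eqxx big1 ?addr0; first by rewrite mulr1n; field.
  by move=> v; rewrite eq_sym => /negbTE ->; rewrite mul0r mulr0 mul0r.
have E : dot f (act M f) + dot f (act M f) =
   \sum_u \sum_v pi u * (M u v - (u == v)%:R / 2) * (f u + f v) ^+ 2.
  have -> : dot f (act M f) + dot f (act M f) =
      dot f f + (dot f (act M f) + dot f (act M f)) + dot f f - 2 * dot f f by ring.
  rewrite -Ddiag -[X in X + _ + _ - _]Du -[X in _ + X - _]Dv -B.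
  rewrite -!big_split -sumrB/=; apply: eq_bigr => u _.
  by rewrite -!big_split -sumrB/=; apply: eq_bigr => v _; ring.
suff : 0 <= dot f (act M f) + dot f (act M f) by lra.
rewrite E; apply: sumr_ge0 => u _; apply: sumr_ge0 => v _.
apply: mulr_ge0; last exact: sqr_ge0.
apply: mulr_ge0 => //; have := lazyM v; have := M0 u v.
case: eqP => [->|_]; rewrite ?mulr1n ?mulr0n; lra.
Qed.

(** With [h = f^2 / g], AM-GM and reversibility give [<f, M f> <= <h, M g>]; the bound on [M g] off
    [w] turns this into [lam * <h, g> = lam * <f, f>]. *)
Lemma schur_test M f g w lam : stochastic M -> reversible M pi ->
  (forall u, 0 <= g u) -> (forall u, u != w -> 0 < g u) ->
  (forall u, u != w -> act M g u <= lam * g u) ->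
  f w = 0 -> dot f (act M f) <= lam * dot f f.
Proof.
move=> [M0 M1] revM g0 gp gl fw.
pose h u := f u ^+ 2 / g u.
have gh u : h u * g u = f u ^+ 2.
  have [->|uw] := eqVneq u w; first by rewrite /h fw expr0n/= !mul0r.
  by rewrite /h divfK// gt_eqF// gp.
have h0 u : 0 <= h u by rewrite divr_ge0// sqr_ge0.
have hw : h w = 0 by rewrite /h fw expr0n/= mul0r.
(* AM-GM: 2 f(u) f(v) <= f(u)^2 g(v) / g(u) + f(v)^2 g(u) / g(v) *)
have key u v : 2 * (f u * f v) <= h u * g v + h v * g u.
  have [->|uw] := eqVneq u w.
    by rewrite hw fw !mul0r mulr0 add0r mulr_ge0.
  have [->|vw] := eqVneq v w.
    by rewrite hw fw !(mul0r,mulr0) addr0 mulr_ge0.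
  have gu := gp _ uw; have gv := gp _ vw.
  rewrite -subr_ge0 -(pmulr_rge0 _ (mulr_gt0 gu gv)).
  have -> : g u * g v * (h u * g v + h v * g u - 2 * (f u * f v)) =
    (h u * g u) * g v ^+ 2 + (h v * g v) * g u ^+ 2 - 2 * (f u * g v) * (f v * g u) by ring.
  rewrite !gh (_ : _ - _ = (f u * g v - f v * g u) ^+ 2); last by ring.
  exact: sqr_ge0.
have le1 : dot f (act M f) <= dot h (act M g).
  suff : 2 * dot f (act M f) <= dot h (act M g) + dot (act M g) h.
    rewrite [dot (act M g) h](_ : _ = dot h (act M g)); last first.
      by apply: eq_bigr => u _; rewrite [act _ _ _ * _]mulrC.
    by lra.
  rewrite -dot_act_sym// /dot -big_split mulr_sumr/=; apply: ler_sum => u _.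
  rewrite mulrCA -mulrDr ler_wpM2l// /act !mulr_sumr -big_split/=.
  apply: ler_sum => v _; have := ler_wpM2l (M0 u v) (key u v); lra.
apply: (le_trans le1); rewrite /dot mulr_sumr; apply: ler_sum => u _.
rewrite [leRHS]mulrCA ler_wpM2l//.
have [->|uw] := eqVneq u w; first by rewrite hw fw !(mul0r, mulr0).
apply: le_trans (ler_wpM2l (h0 u) (gl u uw)) _.
by rewrite mulrCA gh expr2.
Qed.

(** For positive [pi] and reversible [M], this bounds by [lam] every eigenvalue of [M] with the row
    and column of [w] deleted, for each [w]. *)
Definition killed_contraction lam M := forall w f, f w = 0 ->
  dot f (act M f) <= lam * dot f f.

Lemma dot_act_subZ M f g (lam : R) : reversible M pi ->
  dot (fun u => f u - lam * g u) (act M (fun u => f u - lam * g u)) =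
  dot f (act M f) - 2 * lam * dot f (act M g) + lam ^+ 2 * dot g (act M g).
Proof.
move=> revM.
have E u : act M (fun u => f u - lam * g u) u = act M f u - lam * act M g u.
  by rewrite /act mulr_sumr -sumrB; apply: eq_bigr => v _; ring.
have S : dot g (act M f) = dot f (act M g).
  by rewrite dot_act_sym//; apply: eq_bigr => u _; rewrite [act _ _ _ * _]mulrC.
have -> : 2 * lam * dot f (act M g) = lam * dot f (act M g) + lam * dot g (act M f).
  by rewrite S; ring.
rewrite /dot !mulr_sumr -big_split/= -sumrB -big_split/=; apply: eq_bigr => u _.
by rewrite E; ring.
Qed.

(** Positivity of [M] on [f - lam * g] controls the cross term by the two diagonal ones, even when
    [f] and [g] vanish at different vertices. *)
Lemma killed_cross M f g w w' (lam : R) : stochastic M -> reversible M pi -> lazy M ->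
  killed_contraction lam M -> 0 < lam -> f w = 0 -> g w' = 0 ->
  2 * dot f (act M g) <= dot f f + lam ^+ 2 * dot g g.
Proof.
move=> M1 revM lazyM cM lam0 fw gw.
have := lazy_psd (fun u => f u - lam * g u) M1 revM lazyM.
rewrite dot_act_subZ// => H.
have Hf := cM _ _ fw; have Hg := ler_wpM2l (sqr_ge0 lam) (cM _ _ gw).
rewrite -(ler_pM2l lam0).
have -> : lam * (dot f f + lam ^+ 2 * dot g g) = lam * dot f f + lam ^+ 2 * (lam * dot g g) by ring.
have -> : lam * (2 * dot f (act M g)) = 2 * lam * dot f (act M g) by ring.
lra.
Qed.

(* Probability that the walk from u avoids w at all times 0, ..., t. *)
Fixpoint stay M w t u : R :=
  (u != w)%:R * (if t is t'.+1 then act M (stay M w t') u else 1).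

Lemma stay_ge0 M w t u : stochastic M -> 0 <= stay M w t u.
Proof.
move=> M1; elim: t u => [|t IH] u /=; apply: mulr_ge0 => //.
exact: act_ge0.
Qed.

Lemma stay_decr M w t u : stochastic M -> stay M w t.+1 u <= stay M w t u.
Proof.
move=> M1; elim: t u => [|t IH] u; rewrite /= ler_wpM2l//.
  by apply: act_le1 => // v; rewrite mulr1 lern1 leq_b1.
exact: act_le.
Qed.

(** The expected hitting time [g] of [w] satisfies [M g = g - 1 <= (1 - 1/H) g] off [w], so the
    Schur test applies. Truncated sums [G n] stand in for [g], with an error that tends to 0. *)
Lemma hitting_contraction M H : stochastic M -> reversible M pi ->
  (forall w u n, \sum_(t < n) stay M w t u <= H) -> 1 <= H ->
  killed_contraction (1 - H^-1) M.
Proof.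
move=> M1 revM hitH H1 w f fw.
have Hp : 0 < H by lra.
pose G n u := \sum_(t < n) stay M w t u.
have G0 n u : 0 <= G n u by apply: sumr_ge0 => i _; exact: stay_ge0.
have Gge n u : u != w -> 1 <= G n.+1 u.
  move=> uw; rewrite /G big_ord_recl [X in X + _](_ : _ = 1); last by rewrite /= uw mulr1.
  by rewrite lerDl sumr_ge0// => i _; exact: stay_ge0.
(* [stay] decreases in time and its first [n.+1] terms sum to at most [H]. *)
have stayH n u : stay M w n u <= H / n.+1%:R.
  rewrite ler_pdivlMr ?ltr0n//; apply: le_trans (hitH w u n.+1).
  rewrite mulr_natr -[X in _ *+ X]card_ord -sumr_const; apply: ler_sum => i _.
  have : (i <= n)%N by rewrite -ltnS.
  elim: n {i} (i : nat) => [|n IH] i; first by rewrite leqn0 => /eqP ->.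
  rewrite leq_eqVlt => /predU1P[->//|]; rewrite ltnS => /IH; apply: le_trans.
  exact: stay_decr.
have GS n u : u != w -> act M (G n) u = G n.+1 u - 1.
  move=> uw; rewrite /G big_ord_recl [X in X + _ - _](_ : _ = 1); last by rewrite /= uw mulr1.
  rewrite addrAC subrr add0r.
  rewrite /act; under eq_bigr do rewrite mulr_sumr.
  rewrite exchange_big; apply: eq_bigr => i _.
  by rewrite lift0 /= uw mul1r.
have step n : dot f (act M f) <= (1 - H^-1 + H / n.+2%:R) * dot f f.
  apply: (@schur_test M f (G n.+1) w) => // u uw.
    by rewrite (lt_le_trans ltr01)// Gge.
  rewrite GS// {1}/G big_ord_recr/= -/(G n.+1 u).
  have g1 := Gge n _ uw; have gH : G n.+1 u <= H by apply: hitH.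
  have := stayH n.+1 u; set s := (H / _).
  have s0 : 0 <= s by rewrite divr_ge0// ltW.
  have : H^-1 * G n.+1 u <= 1 by rewrite mulrC ler_pdivrMr// mul1r.
  have : s <= s * G n.+1 u by rewrite ler_peMr.
  by rewrite /stay -/stay; lra.
apply/ler_addgt0Pr => e e0.
pose n := Num.truncn (H * dot f f / e).
apply: le_trans (step n) _; rewrite mulrDl lerD2l.
rewrite mulrAC ler_pdivrMr ?ltr0n// mulrC -ler_pdivrMl// mulrC.
apply: le_trans (ltW (truncnS_gt _)) _.
by rewrite ler_nat [e^-1 * _]mulrC -/n ltnS leqnSn.
Qed.

(** The test function is the indicator of the complement of [w]; laziness at [w] gives the factor 2.
    The bound serves to derive [pi > 0] and [#|V| <= N]. *)
Lemma killed_contraction_mass M H w : stochastic M -> reversible M pi -> lazy M ->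
  \sum_u pi u = 1 -> 0 < H -> killed_contraction (1 - H^-1) M ->
  2 * (1 - pi w) <= H * pi w.
Proof.
move=> M1 revM lazyM pi1 Hp cM.
have := cM w (fun u => (u != w)%:R); rewrite eqxx => /(_ erefl).
have -> : dot (fun u => (u != w)%:R) (fun u => (u != w)%:R) = 1 - pi w.
  rewrite /dot -[in RHS]pi1 (bigD1 w)//= [in RHS](bigD1 w)//= eqxx !mul0r mulr0 add0r addrC addrK.
  by apply: eq_bigr => u ->; rewrite mulr1n !mulr1.
have actE u : act M (fun u => (u != w)%:R) u = 1 - M u w.
  rewrite /act -[in RHS](M1.2 u) (bigD1 w)//= [in RHS](bigD1 w)//= eqxx mulr0 add0r addrC addrK.
  by apply: eq_bigr => v ->; rewrite mulr1n ?mulr1 ?mul1r.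
have -> : dot (fun u => (u != w)%:R) (act M (fun u => (u != w)%:R)) =
    1 - 2 * pi w + pi w * M w w.
  rewrite dot_act_sym// /dot.
  under eq_bigr do rewrite actE.
  have S : \sum_u pi u * (1 - M u w) = 1 - pi w.
    under eq_bigr do rewrite mulrBr mulr1 revM.
    by rewrite sumrB pi1 -mulr_sumr M1.2 mulr1.
  rewrite (bigD1 w)//= eqxx mulr0 mulr0 add0r.
  move: S; rewrite (bigD1 w)//= => /(canRL (addKr _)) S.
  transitivity (\sum_(i | i != w) pi i * (1 - M i w)).
    by apply: eq_bigr => u ->; rewrite mulr1n ?mulr1 ?mul1r.
  by rewrite S; ring.
have : pi w * (1 / 2) <= pi w * M w w by rewrite ler_wpM2l.
move=> h1 h2.
have h3 : H^-1 * (1 - pi w) <= pi w / 2 by lra.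
have := ler_wpM2l (ltW Hp) h3; rewrite mulrA divff ?gt_eqF// mul1r; lra.
Qed.

End kernels.

(** * Avoiding trajectories, and mixing *)

Section trajectories.
Context (R : realType) (V : finType).
Implicit Types (Q : nat -> V -> V -> R) (f g : V -> R) (W : pred nat) (h : seq V).

(** Inhomogeneous semigroup: the mean of [f] at time [t + m] for a walk at [x] at time [t]. *)
Fixpoint evolve Q m t f x : R :=
  if m is m'.+1 then act (Q t) (evolve Q m' t.+1 f) x else f x.

(* Probability that a walk from x at time t is never at the vertex prescribed
   by h (h_0 at time t, h_1 at time t+1, ...) at a time satisfying W. *)
Fixpoint miss Q W t h x : R :=
  if h is v :: h' then (~~ (W t && (x == v)))%:R * act (Q t) (miss Q W t.+1 h') x
  else 1.

(* Expectation of F over the walk from v, observed at times t, ..., t+m-1. *)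
Fixpoint path_mean Q m t v (F : seq V -> R) : R :=
  if m is m'.+1 then
    act (Q t) (fun v' => path_mean Q m' t.+1 v' (fun h => F (v :: h))) v
  else F [::].

Variable Q : nat -> V -> V -> R.
Hypothesis stoQ : forall t, stochastic (Q t).

Let Q0 t u v : 0 <= Q t u v. Proof. exact: (stoQ t).1. Qed.

Lemma evolveD m n t f : evolve Q (m + n) t f =1 evolve Q m t (evolve Q n (t + m) f).
Proof.
elim: m t => [|m IH] t x; first by rewrite addn0.
by rewrite addSn /= -addSnnS; congr (act _ _ _); apply/funext => y; exact: IH.
Qed.

Lemma evolve_sum m t f x :
  evolve Q m t f x = \sum_z f z * evolve Q m t (fun v => (v == z)%:R) x.
Proof.
elim: m t x => [|m IH] t x /=.
  rewrite (bigD1 x)//= eqxx mulr1 big1 ?addr0// => z.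
  by rewrite eq_sym => /negbTE ->; rewrite mulr0.
transitivity (\sum_v \sum_z Q t x v * (f z * evolve Q m t.+1 (fun v => (v == z)%:R) v)).
  by apply: eq_bigr => v _; rewrite IH mulr_sumr.
rewrite exchange_big; apply: eq_bigr => z _ /=; rewrite mulr_sumr.
by apply: eq_bigr => v _; rewrite mulrCA.
Qed.

Lemma evolve_ge0 m t f x : (forall v, 0 <= f v) -> 0 <= evolve Q m t f x.
Proof. by move=> f0; elim: m t x => [|m IH] t x //=; exact: act_ge0. Qed.

Lemma evolve_cst m t c x : evolve Q m t (fun=> c) x = c.
Proof.
elim: m t x => [//|m IH] t x /=; rewrite -[RHS](act_cst c x (stoQ t)).
by congr (act _ _ _); apply/funext.
Qed.

Lemma evolveB m t f g x :
  evolve Q m t (fun v => f v - g v) x = evolve Q m t f x - evolve Q m t g x.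
Proof.
rewrite !(evolve_sum _ _ _ x) -sumrB; apply: eq_bigr => z _; by rewrite mulrBl.
Qed.

Lemma evolve_le1 m t f x : (forall v, f v <= 1) -> evolve Q m t f x <= 1.
Proof.
move=> f1; rewrite -subr_ge0 -(evolve_cst m t 1 x) -evolveB.
by apply: evolve_ge0 => v; rewrite subr_ge0.
Qed.

Lemma miss_ge0 W t h x : 0 <= miss Q W t h x.
Proof. by elim: h t x => [|v h IH] t x //=; rewrite mulr_ge0// act_ge0. Qed.

Lemma miss_le1 W t h x : miss Q W t h x <= 1.
Proof.
elim: h t x => [|v h IH] t x //=; apply: mulr_ile1; rewrite ?lern1 ?leq_b1//.
  by apply: act_ge0 => // y; exact: miss_ge0.
exact: act_le1.
Qed.

Lemma miss_evolve W m t h x : (forall i, (i < m)%N -> ~~ W (t + i)%N) -> (m <= size h)%N ->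
  miss Q W t h x = evolve Q m t (miss Q W (t + m) (drop m h)) x.
Proof.
elim: m t h x => [|m IH] t h x Wm; first by rewrite drop0 addn0.
case: h => [//|v h] /=; rewrite ltnS => mh.
have := Wm 0%N isT; rewrite addn0 => /negbTE -> /=; rewrite mul1r -addSnnS.
congr (act _ _ _); apply/funext => y; apply: IH => // i im.
by rewrite addSnnS Wm.
Qed.

Lemma path_mean_sum m t v (I : finType) (F : I -> seq V -> R) :
  path_mean Q m t v (fun h => \sum_i F i h) = \sum_i path_mean Q m t v (F i).
Proof.
elim: m t v F => [//|m IH] t v F /=; rewrite /act exchange_big/=.
by apply: eq_bigr => v' _; rewrite IH mulr_sumr.
Qed.

Lemma path_mean_scale m t v c (F : seq V -> R) :
  path_mean Q m t v (fun h => c * F h) = c * path_mean Q m t v F.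
Proof.
elim: m t v F => [//|m IH] t v F /=; rewrite /act mulr_sumr.
by apply: eq_bigr => v' _; rewrite IH mulrCA.
Qed.

Lemma eq_path_mean m t v (F G : seq V -> R) : F =1 G ->
  path_mean Q m t v F = path_mean Q m t v G.
Proof. by move=> /funext ->. Qed.

Lemma path_mean_le m t v (F : seq V -> R) c :
  (forall h, size h = m -> F h <= c) -> path_mean Q m t v F <= c.
Proof.
elim: m t v F => [|m IH] t v F Fc /=; first exact: Fc.
rewrite -[leRHS](act_cst c v (stoQ t)); apply: act_le => // v'.
by apply: IH => h hm; apply: Fc; rewrite /= hm.
Qed.

Lemma path_mean_ge0 m t v (F : seq V -> R) :
  (forall h, 0 <= F h) -> 0 <= path_mean Q m t v F.
Proof.
elim: m t v F => [|m IH] t v F F0 /=; first exact: F0.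
by apply: act_ge0 => // v'; exact: IH.
Qed.

(* Two independent walks moved together from their first meeting on. *)
Lemma evolve_coupling m t f x y : (forall v, 0 <= f v <= 1) ->
  evolve Q m t f x - evolve Q m t f y <=
  path_mean Q m t x (fun h => miss Q xpredT t h y).
Proof.
move=> f01; elim: m t x y => [|m IH] t x y.
  by have := f01 x; have := f01 y => /=; lra.
have [->|xy] := eqVneq x y.
  by rewrite subrr; apply: path_mean_ge0 => h; exact: miss_ge0.
(* Before meeting, the walks move independently, so both sides are averages over the same product of
   one-step kernels. *)
have -> : path_mean Q m.+1 t x (fun h => miss Q xpredT t h y) =
    \sum_x' \sum_y' Q t x x' * Q t y y' *
      path_mean Q m t.+1 x' (fun h => miss Q xpredT t.+1 h y').
  apply: eq_bigr => x' _.
  under eq_bigr do rewrite -mulrA -path_mean_scale.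
  rewrite -mulr_sumr -path_mean_sum; congr (_ * _); apply: eq_path_mean => h /=.
  by rewrite eq_sym xy mul1r.
have -> : evolve Q m.+1 t f x - evolve Q m.+1 t f y =
    \sum_x' \sum_y' Q t x x' * Q t y y' * (evolve Q m t.+1 f x' - evolve Q m t.+1 f y').
  transitivity (\sum_x' \sum_y' Q t x x' * Q t y y' * evolve Q m t.+1 f x' -
     \sum_x' \sum_y' Q t x x' * Q t y y' * evolve Q m t.+1 f y').
    congr (_ - _).
      apply: eq_bigr => x' _; rewrite -mulr_suml -mulr_sumr.
      by rewrite (stoQ t).2 mulr1.
    rewrite exchange_big; apply: eq_bigr => y' _ /=.
    by rewrite -!mulr_suml (stoQ t).2 mul1r.
  rewrite -sumrB; apply: eq_bigr => x' _; rewrite -sumrB.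
  by apply: eq_bigr => y' _; rewrite mulrBr.
apply: ler_sum => x' _; apply: ler_sum => y' _.
by apply: ler_wpM2l; [rewrite mulr_ge0|exact: IH].
Qed.

End trajectories.

(** * Meeting a trajectory, total variation mixing and minorization *)

Section mixing.
Context (R : realType) (V : finType) (pi : V -> R) (lam : R).
Hypotheses (pip : forall v, 0 < pi v) (pi1 : \sum_v pi v = 1) (lam0 : 0 < lam).
Implicit Types (Q : nat -> V -> V -> R) (f g : V -> R) (W : pred nat) (h : seq V).

Let pi0 v : 0 <= pi v. Proof. exact: ltW. Qed.

Definition admissible (M : V -> V -> R) :=
  [/\ stochastic M, reversible M pi, lazy M & killed_contraction pi lam M].

(** Let [f] and [g] be [miss] from [t] and from [t.+1]. Since [f] is [Q_t g] set to 0 at one vertex,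
    [<f, Q_t g> = <f, f>], and [killed_cross] becomes [<f, f> <= lam^2 <g, g>]. The last of the
    [m.+1] times gives no factor. *)
Lemma miss_norm Q W t h m : (forall t, admissible (Q t)) ->
  (forall i, (i <= m)%N -> W (t + i)%N) -> (m < size h)%N ->
  dot pi (miss Q W t h) (miss Q W t h) <= lam ^+ (m.*2).
Proof.
move=> adQ; have stoQ t' : stochastic (Q t') by have [] := adQ t'.
elim: m t h => [|m IH] t h Wm mh.
  rewrite expr0 -pi1; apply: ler_sum => u _; rewrite -[leRHS]mulr1 ler_wpM2l//.
  by rewrite mulr_ile1// ?miss_ge0// miss_le1.
case: h mh => [//|v [//|v' h]]; rewrite [size _]/= ltnS => mh.
have Wt : W t by have := Wm 0%N isT; rewrite addn0.
have Wt1 : W t.+1 by have := Wm 1%N isT; rewrite addn1.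
have [_ revM lazyM cM] := adQ t.
have fv : miss Q W t (v :: v' :: h) v = 0 by rewrite /= Wt eqxx mul0r.
have gv : miss Q W t.+1 (v' :: h) v' = 0 by rewrite /= Wt1 eqxx mul0r.
have := killed_cross pi0 (stoQ t) revM lazyM cM lam0 fv gv.
have -> : dot pi (miss Q W t (v :: v' :: h)) (act (Q t) (miss Q W t.+1 (v' :: h))) =
   dot pi (miss Q W t (v :: v' :: h)) (miss Q W t (v :: v' :: h)).
  apply: eq_bigr => u _; congr (_ * _); rewrite [miss Q W t (v :: _) _]/=.
  by case: (W t && _); rewrite /= ?mul0r// mul1r.
have /(ler_wpM2l (sqr_ge0 lam)) :
    dot pi (miss Q W t.+1 (v' :: h)) (miss Q W t.+1 (v' :: h)) <= lam ^+ m.*2.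
  by apply: IH => // i im; rewrite addSnnS Wm.
rewrite -exprD doubleS !add2n; lra.
Qed.

(** Cauchy-Schwarz against the constant 1, in the form of a nonnegative variance. *)
Lemma miss_mass Q W t h m : (forall t, admissible (Q t)) ->
  (forall i, (i <= m)%N -> W (t + i)%N) -> (m < size h)%N ->
  \sum_u pi u * miss Q W t h u <= lam ^+ m.
Proof.
move=> adQ Wm mh; have := miss_norm adQ Wm mh; set f := miss _ _ _ _ => H.
have lm : 0 <= lam ^+ m by apply: exprn_ge0; exact: ltW.
rewrite -(@ler_pXn2r _ 2)// ?nnegrE ?sumr_ge0//; last first.
  move=> u _; rewrite mulr_ge0// /f miss_ge0// => t'.
  by have [] := adQ t'.
rewrite -exprM muln2; apply: le_trans H.
set s := (X in X ^+ 2); have sE : \sum_u pi u * f u = s by [].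
move: s sE => s sE; have : 0 <= \sum_u pi u * (f u - s) ^+ 2.
  by apply: sumr_ge0 => u _; rewrite mulr_ge0// sqr_ge0.
have -> : \sum_u pi u * (f u - s) ^+ 2 =
    dot pi f f - 2 * s * (\sum_u pi u * f u) + s ^+ 2 * \sum_u pi u.
  rewrite /dot !mulr_sumr -sumrB -big_split/=; apply: eq_bigr => u _; ring.
rewrite pi1 sE; lra.
Qed.

Lemma pi_evolve Q m t f : (forall t, admissible (Q t)) ->
  \sum_u pi u * evolve Q m t f u = \sum_u pi u * f u.
Proof.
move=> adQ; elim: m t => [//|m IH] t /=.
by have [? ? _ _] := adQ t; rewrite pi_act.
Qed.

(** The coupling bound is averaged over a stationary [y]; once the trajectory from [x] is frozen,
    [miss_mass] applies to it. *)
Lemma evolve_mixing Q m t f x : (forall t, admissible (Q t)) ->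
  (forall v, 0 <= f v <= 1) ->
  `|evolve Q m.+1 t f x - \sum_u pi u * f u| <= lam ^+ m.
Proof.
move=> adQ; have stoQ t' : stochastic (Q t') by have [] := adQ t'.
(* One side suffices: the other follows from [1 - f]. *)
suff key g : (forall v, 0 <= g v <= 1) ->
    evolve Q m.+1 t g x - \sum_u pi u * g u <= lam ^+ m.
  move=> f01; rewrite ler_norml key// andbT lerNl opprB.
  have := key (fun v => 1 - f v); rewrite evolveB// evolve_cst//.
  have -> : \sum_u pi u * (1 - f u) = 1 - \sum_u pi u * f u.
    by rewrite -[X in _ = X - _]pi1 -sumrB; apply: eq_bigr => u _; rewrite mulrBr mulr1.
  set a := evolve _ _ _ _ _; set b := \sum_u _.
  have -> : 1 - a - (1 - b) = b - a by ring.
  by apply => v; have := f01 v; lra.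
move=> g01; rewrite -(pi_evolve m.+1 t g adQ).
rewrite -[X in X - _]mul1r -pi1 mulr_suml -sumrB.
apply: (@le_trans _ _ (\sum_y pi y * path_mean Q m.+1 t x (fun h => miss Q xpredT t h y))).
  apply: ler_sum => y _; rewrite -mulrBr ler_wpM2l//.
  exact: evolve_coupling.
under eq_bigr do rewrite -path_mean_scale//.
rewrite -path_mean_sum//; apply: path_mean_le => // h hm.
by apply: miss_mass => //; rewrite hm.
Qed.

(** Each factor is self-adjoint in [L^2(pi)], so the adjoint runs the kernels in reverse order. *)
Lemma evolve_adjoint Q m t f g : (forall t, admissible (Q t)) ->
  dot pi f (evolve Q m t g) = dot pi (evolve (fun i => Q (t + m - i.+1)%N) m 0 f) g.
Proof.
move=> adQ; elim: m t f => [//|m IH] t f.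
have [_ revM _ _] := adQ t.
rewrite -[LHS]/(dot pi f (act (Q t) (evolve Q m t.+1 g))).
rewrite dot_act_sym// IH; congr (dot pi _ g); apply/funext => x.
rewrite -[in RHS](addn1 m) evolveD add0n addn1 addnS -addSn.
congr (evolve _ m 0 _ x); apply/funext => y.
by rewrite /= addSn subSS addnK.
Qed.

(* Split 2(m+1) steps into two halves; by reversibility the transition density
   is sum_z p(z) p'(z) / pi(z) with p, p' within lam^m of pi in total variation. *)
Lemma evolve_minorization Q m t f x : (forall t, admissible (Q t)) ->
  (forall v, 0 <= f v) ->
  (1 - 4 * lam ^+ m) * (\sum_u pi u * f u) <= evolve Q (m.+1 + m.+1) t f x.
Proof.
move=> adQ f0; have stoQ t' : stochastic (Q t') by have [] := adQ t'.
rewrite [leRHS]evolve_sum mulr_sumr; apply: ler_sum => y _.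
rewrite mulrA mulrC ler_wpM2l// evolveD.
set S := fun i => Q (t + m.+1 + m.+1 - i.+1)%N.
have adS i : admissible (S i) by exact: adQ.
have stoS i : stochastic (S i) by exact: stoQ.
pose p z := evolve Q m.+1 t (fun v => (v == z)%:R) x.
pose p' z := evolve S m.+1 0 (fun v => (v == z)%:R) y.
have p0 z : 0 <= p z by apply: evolve_ge0.
have p'0 z : 0 <= p' z by apply: evolve_ge0.
have rev z : pi z * evolve Q m.+1 (t + m.+1) (fun v => (v == y)%:R) z = pi y * p' z.
  have := evolve_adjoint m.+1 (t + m.+1) (fun v => (v == z)%:R) (fun v => (v == y)%:R) adQ.
  rewrite /dot (bigD1 z)//= eqxx mul1r big1 ?addr0; last by move=> i /negbTE ->; rewrite mul0r mulr0.
  move=> ->; rewrite (bigD1 y)//= eqxx mulr1 big1 ?addr0// => i /negbTE ->.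
  by rewrite !mulr0.
rewrite evolve_sum.
have -> : \sum_z evolve Q m.+1 (t + m.+1) (fun v => (v == y)%:R) z *
   evolve Q m.+1 t (fun v => (v == z)%:R) x = pi y * \sum_z p z * p' z / pi z.
  rewrite mulr_sumr; apply: eq_bigr => z _; rewrite -/(p z).
  have := rev z; set e := evolve _ _ _ _ _ => E.
  have pz : pi z != 0 by rewrite gt_eqF.
  by rewrite (_ : e = pi y * p' z / pi z); [field|rewrite -E mulrAC divff// mul1r].
rewrite mulrC ler_wpM2l//.
(* On the event [A] the masses of [p] and [p'] differ most, so the sum of the minima is one minus
   their total variation distance. *)
pose A z := (p' z < p z)%R.
have sum_p : \sum_z p z = 1.
  have := evolve_sum Q m.+1 t (fun=> 1) x; rewrite evolve_cst// => ->.
  by apply: eq_bigr => z _; rewrite mul1r.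
have pA : \sum_(z | A z) p z = evolve Q m.+1 t (fun v => (A v)%:R) x.
  rewrite evolve_sum big_mkcond; apply: eq_bigr => z _ /=.
  by case: (A z); rewrite ?mul1r ?mul0r.
have p'A : \sum_(z | A z) p' z = evolve S m.+1 0 (fun v => (A v)%:R) y.
  rewrite evolve_sum big_mkcond; apply: eq_bigr => z _ /=.
  by case: (A z); rewrite ?mul1r ?mul0r.
have A01 v : 0 <= ((A v)%:R : R) <= 1 by rewrite ler0n lern1 leq_b1.
have min_ge : 1 - 2 * lam ^+ m <= \sum_z Num.min (p z) (p' z).
  have := evolve_mixing m t x adQ A01; have := evolve_mixing m 0 y adS A01.
  rewrite -pA -p'A !ler_norml => /andP[h1 _] /andP[_ h2].
  have -> : \sum_z Num.min (p z) (p' z) = 1 - (\sum_(z | A z) p z - \sum_(z | A z) p' z).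
    rewrite -sum_p [X in X - _](bigID A)/= [LHS](bigID A)/=.
    rewrite opprB addrCA addrAC subrr add0r; congr (_ + _); apply: eq_bigr => z.
      by rewrite /A => zA; rewrite minElt ltNge ltW.
    by rewrite /A -leNgt => zA; rewrite minEle zA.
  lra.
(* For the minimum [a], [p z * p' z >= a^2], and [a^2 / pi z >= 2 a - pi z] because
   [(a - pi z)^2 >= 0]. *)
apply: (@le_trans _ _ (\sum_z (2 * Num.min (p z) (p' z) - pi z))).
  by rewrite sumrB pi1 -mulr_sumr; lra.
apply: ler_sum => z _; rewrite ler_pdivlMr//.
have : Num.min (p z) (p' z) ^+ 2 <= p z * p' z.
  rewrite expr2; case: (leP (p z) (p' z)) => hz; first by rewrite ler_wpM2l.
  by rewrite ler_wpM2r// ltW.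
set a := Num.min _ _; have := sqr_ge0 (a - pi z).
move=> h1; apply: le_trans.
have -> : (2 * a - pi z) * pi z = a ^+ 2 - (a - pi z) ^+ 2 by ring.
lra.
Qed.

(** By minorization the walk is stationary after mixing with weight at least [1 - e]; on that part
    avoidance costs [lam^d], and the rest is bounded by [e]. The extra steps up to [s] preserve
    [pi]. *)
Lemma miss_after_mixing Q W m s h x d e : (forall t, admissible (Q t)) ->
  (m.+1 + m.+1 <= s)%N -> (forall t, (t < s)%N -> ~~ W t) ->
  (forall i, (i <= d)%N -> W (s + i)%N) -> (s + d < size h)%N ->
  4 * lam ^+ m <= e -> e <= 1 ->
  miss Q W 0 h x <= e + (1 - e) * lam ^+ d.
Proof.
move=> adQ ms W0 W1 sh le_e e1; have stoQ t' : stochastic (Q t') by have [] := adQ t'.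
rewrite (@miss_evolve _ _ _ _ s)//; last first.
  by apply: leq_trans (ltnW sh); exact: leq_addr.
rewrite add0n -(subnKC ms) evolveD add0n.
set g := evolve Q (s - _)%N _ _.
have g0 v : 0 <= g v by apply: evolve_ge0 => // u; exact: miss_ge0.
have g1 v : g v <= 1 by apply: evolve_le1 => // u; exact: miss_le1.
have := @evolve_minorization Q m 0 (fun v => 1 - g v) x adQ.
rewrite evolveB// evolve_cst//.
have -> : \sum_u pi u * (1 - g u) = 1 - \sum_u pi u * g u.
  by rewrite -[X in _ = X - _]pi1 -sumrB; apply: eq_bigr => u _; rewrite mulrBr mulr1.
have gl : \sum_u pi u * g u <= lam ^+ d.
  rewrite pi_evolve// (subnKC ms); apply: miss_mass => //.
  by rewrite size_drop ltn_subRL.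
have gs : \sum_u pi u * g u <= 1.
  by rewrite -[leRHS]pi1; apply: ler_sum => u _; rewrite -[leRHS]mulr1 ler_wpM2l.
have g0' v : 0 <= 1 - g v by rewrite subr_ge0.
move=> /(_ g0'); set G := \sum_u pi u * g u; rewrite -/G in gl gs * => H.
have : (1 - e) * (1 - G) <= (1 - 4 * lam ^+ m) * (1 - G) by rewrite ler_wpM2r; lra.
have : (1 - e) * G <= (1 - e) * lam ^+ d by rewrite ler_wpM2l; lra.
lra.
Qed.

End mixing.

(** * Coalescing walks and independent walkers *)

Section avoidance.
Context (R : realType) (S : finType).
Implicit Types (K : nat -> S -> S -> R) (A : pred S).

(** Here [K t] drives the step leaving time [t], so the kernels of [avoid_prob] enter shifted by
    one. *)
Fixpoint avoid_from K A m t x : R :=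
  (~~ A x)%:R * (if m is m'.+1 then act (K t) (avoid_from K A m' t.+1) x else 1).

Definition path_cons m (s : S) (q : {ffun 'I_m.+1 -> S}) : {ffun 'I_m.+2 -> S} :=
  [ffun i => if unlift ord0 i is Some j then q j else s].

Lemma path_cons0 m s (q : {ffun 'I_m.+1 -> S}) : path_cons s q ord0 = s.
Proof. by rewrite ffunE unlift_none. Qed.

Lemma path_cons_lift m s (q : {ffun 'I_m.+1 -> S}) j : path_cons s q (lift ord0 j) = q j.
Proof. by rewrite ffunE liftK. Qed.

Lemma path_consS m s (q : {ffun 'I_m.+1 -> S}) i : (i <= m)%N ->
  path_cons s q (inord i.+1) = q (inord i).
Proof.
move=> im; have -> : inord i.+1 = lift ord0 (inord i) :> 'I_m.+2.
  by apply: ord_inj; rewrite lift0 !inordK.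
exact: path_cons_lift.
Qed.

Lemma avoid_probS K A m x : avoid_prob K x A m.+1 =
  (~~ A x)%:R * \sum_x' K 1%N x x' * avoid_prob (fun i => K i.+1) x' A m.
Proof.
rewrite /avoid_prob.
transitivity (\sum_(sq : S * {ffun 'I_m.+1 -> S} | ~~ A sq.1 && [forall i, ~~ A (sq.2 i)])
  ((x == sq.1)%:R * (K 1%N sq.1 (sq.2 ord0) *
     \prod_(i < m) K i.+2 (sq.2 (inord i)) (sq.2 (inord i.+1))))).
  rewrite (reindex (fun sq : S * {ffun 'I_m.+1 -> S} => path_cons sq.1 sq.2))/=; last first.
    exists (fun p => (p ord0, [ffun j => p (lift ord0 j)])) => [[s q] _|p _] /=.
      rewrite path_cons0; congr pair; apply/ffunP => j.
      by rewrite ffunE path_cons_lift.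
    apply/ffunP => i; rewrite ffunE; case: unliftP => [j ->|->//].
    by rewrite ffunE.
  apply: eq_big => [[s q] /=|[s q] _ /=].
    apply/forallP/andP => [H|[As /forallP H] i].
      split; first by have := H ord0; rewrite path_cons0.
      by apply/forallP => j; have := H (lift ord0 j); rewrite path_cons_lift.
    by case: (unliftP ord0 i) => [j ->|->]; rewrite ?path_cons0 ?path_cons_lift.
  rewrite path_cons0 big_ord_recl; congr (_ * (_ * _)).
    have -> : inord (ord0 : 'I_m.+1) = ord0 :> 'I_m.+2 by apply: ord_inj; rewrite inordK.
    rewrite path_cons0 path_consS//; congr (K _ s (q _)).
    by apply: ord_inj; rewrite inordK.
  apply: eq_bigr => i _; rewrite lift0; congr (K _ _ _).
    by rewrite path_consS// ltnW.
  by rewrite path_consS.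
transitivity (\sum_(s | ~~ A s) \sum_(q : {ffun 'I_m.+1 -> S} | [forall i, ~~ A (q i)])
  ((x == s)%:R * (K 1%N s (q ord0) *
     \prod_(i < m) K i.+2 (q (inord i)) (q (inord i.+1))))).
  by rewrite pair_big_dep.
rewrite [LHS]big_mkcond [LHS](bigD1 x)//= [X in _ + X]big1 ?addr0; last first.
  move=> s sx; have {sx}/negbTE sx : x != s by rewrite eq_sym.
  case: ifP => // _.
  by rewrite big1// => q _; rewrite sx mul0r.
case: (A x); rewrite /= ?mul0r// mul1r eqxx.
rewrite [RHS](eq_bigr (fun x' => \sum_(q : {ffun 'I_m.+1 -> S} | [forall i, ~~ A (q i)])
   ((x' == q ord0)%:R * (K 1%N x (q ord0) *
     \prod_(i < m) K i.+2 (q (inord i)) (q (inord i.+1)))))); last first.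
  move=> x' _; rewrite mulr_sumr; apply: eq_bigr => q _.
  by case: eqP => [->|_]; rewrite ?mul1r// !mul0r mulr0.
rewrite exchange_big; apply: eq_bigr => q _ /=; rewrite mul1r -mulr_suml.
rewrite [X in _ = X * _](bigD1 (q ord0))//= eqxx [X in _ + X]big1 ?addr0 ?mul1r// => s.
by move=> /negbTE ->.
Qed.

Lemma avoid_probE K A m x : avoid_prob K x A m = avoid_from (fun t => K t.+1) A m 0 x.
Proof.
suff key t : avoid_prob (fun i => K (t + i)%N) x A m = avoid_from (fun t => K t.+1) A m t x.
  exact: key 0%N.
elim: m t x => [|m IH] t x.
  rewrite /avoid_prob /=.
  rewrite (reindex (fun s : S => [ffun _ : 'I_1 => s]))/=; last first.
    exists (fun p => p ord0) => [s _|p _]; first by rewrite ffunE.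
    by apply/ffunP => i; rewrite ffunE (ord1 i).
  rewrite [LHS]big_mkcond [LHS](bigD1 x)//= [X in _ + X]big1 ?addr0 => [|s sx].
    rewrite big_ord0 !mulr1 ffunE eqxx/=.
    have -> : [forall i : 'I_1, ~~ A ([ffun=> x] i)] = ~~ A x.
      by apply/forallP/idP => [/(_ ord0)|H i]; rewrite ffunE.
    by case: (A x).
  by rewrite ffunE eq_sym (negbTE sx) mul0r if_same.
rewrite avoid_probS /=; congr (_ * _); apply: eq_bigr => x' _.
rewrite addn1; congr (_ * _); rewrite -IH.
by congr (avoid_prob _ x' A m); apply/funext => i; rewrite addSnnS.
Qed.

Variable K : nat -> S -> S -> R.
Hypothesis stoK : forall t, stochastic (K t).

Lemma avoid_from_ge0 A m t x : 0 <= avoid_from K A m t x.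
Proof. by elim: m t x => [|m IH] t x /=; rewrite mulr_ge0// act_ge0. Qed.

Lemma avoid_from_le1 A m t x : avoid_from K A m t x <= 1.
Proof.
elim: m t x => [|m IH] t x /=; first by rewrite mulr1 lern1 leq_b1.
by rewrite mulr_ile1 ?act_ge0 ?act_le1 ?lern1 ?leq_b1// => y; exact: avoid_from_ge0.
Qed.

Lemma avoid_from_addr A L m t x (c : R) :
  (forall t x, avoid_from K A L t x <= c) -> 0 <= c ->
  avoid_from K A (m + L) t x <= c * avoid_from K A m t x.
Proof.
move=> Lc c0; elim: m t x => [|m IH] t x.
  rewrite add0n [avoid_from _ _ 0 _ _]/= mulr1.
  have := Lc t x; case: L {Lc} => [|L] /=; case: (A x); rewrite /= ?mul0r ?mulr0 ?mulr1 ?mul1r//.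
rewrite addSn /= mulrCA ler_wpM2l//.
have -> : c * act (K t) (avoid_from K A m t.+1) x =
   act (K t) (fun y => c * avoid_from K A m t.+1 y) x.
  by rewrite /act mulr_sumr; apply: eq_bigr => y _; rewrite mulrCA.
exact: act_le.
Qed.

(** Repeated trials of length [L]: shifting a term by [L] at least halves it, so the partial sum [s]
    obeys [s <= L + s / 2]. *)
Lemma sum_avoid_from A L t x : (forall t x, avoid_from K A L t x <= 1 / 2) ->
  forall M, \sum_(m < M) avoid_from K A m t x <= 2 * L%:R.
Proof.
move=> Lc M.
have le1 : \sum_(m < M) avoid_from K A m t x <= \sum_(m < L + M) avoid_from K A m t x.
  rewrite addnC big_split_ord/= lerDl sumr_ge0// => i _; exact: avoid_from_ge0.
have : \sum_(m < L + M) avoid_from K A m t x <=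
    L%:R + 1 / 2 * \sum_(m < M) avoid_from K A m t x.
  rewrite big_split_ord/= mulr_sumr lerD//.
    rewrite -[L in leRHS]card_ord -sumr_const; apply: ler_sum => i _.
    exact: avoid_from_le1.
  by apply: ler_sum => i _; rewrite addnC avoid_from_addr.
lra.
Qed.

End avoidance.

Lemma prod_indicator (R : realType) (I : finType) (P b : pred I) :
  \prod_(i | P i) (b i)%:R = [forall i, P i ==> b i]%:R :> R.
Proof.
have [/forallP H|/forallPn[i]] := boolP [forall i, P i ==> b i].
  by rewrite big1// => i /(implyP (H i)) ->.
by rewrite negb_imply => /andP[Pi /negbTE bi]; rewrite (bigD1 i)//= bi mul0r.
Qed.

(** * Domination of coalescing walks by independent walkers with killing *)

Section coupling.
Context (R : realType) (V : finType).
Local Notation n := #|V|.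
Implicit Types (P : V -> V -> R) (c y : positions V).

Definition move P y y' : R := \prod_(b < n) P (y b) (y' b).

Lemma move_stochastic P : stochastic P -> stochastic (move P).
Proof.
move=> [P0 P1]; split => [y y'|y]; first exact: prodr_ge0.
rewrite -(bigA_distr_bigA (fun b u => P (y b) u))/=.
by rewrite big1// => b _.
Qed.

(* Each occupied vertex v is followed by one independent walker r v standing there. *)
Lemma coal_step_move P c y (r : V -> 'I_n) c' : stochastic P ->
  (forall a, y (r (c a)) = c a) ->
  coal_step P c c' = \sum_y' move P y y' * (c' == [ffun a => y' (r (c a))])%:R.
Proof.
move=> [P0 P1] yr.
(* Walker [b] moves to [u], which must be the place in [c'] of every walk that follows [b]. *)
pose F b u : R := P (y b) u * ([forall a, (r (c a) == b) ==> (u == c' a)])%:R.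
have -> : \sum_y' move P y y' * (c' == [ffun a => y' (r (c a))])%:R = \prod_b \sum_u F b u.
  rewrite bigA_distr_bigA; apply: eq_bigr => y' _.
  rewrite big_split/=; congr (_ * _).
  rewrite prod_indicator; congr (nat_of_bool _)%:R.
  apply/eqP/forallP => [-> b|H].
    by apply/forallP => a; apply/implyP => /eqP <-; rewrite ffunE.
  apply/ffunP => a; rewrite ffunE.
  by have /forallP/(_ a) := H (r (c a)); rewrite eqxx => /eqP ->.
(* The leaders are exactly the walkers that [coal_step] samples. *)
pose leader (a : 'I_n) := ~~ [exists b : 'I_n, (b < a)%N && (c b == c a)].
have leaderP a : exists2 b, leader b & c b = c a.
  have exb : exists b : 'I_n, c b == c a by exists a.
  case: (arg_minnP (P := [pred b | c b == c a]) val (eqxx (c a))) => b /eqP cb bmin.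
  exists b => //; apply/negP => /existsP[b' /andP[lt /eqP cb']].
  by have := bmin b'; rewrite inE cb' cb eqxx leqNgt lt => /(_ isT).
(* If [c'] separates two walkers sharing a vertex in [c], both sides vanish. *)
have [cc'|/forallPn[a /forallPn[a']]] :=
   boolP [forall a, forall a', (c a == c a') ==> (c' a == c' a')]; last first.
  rewrite negb_imply => /andP[/eqP caa' c'aa'].
  transitivity (0 : R); last first.
    apply/esym/eqP; rewrite (bigD1 (r (c a)))//= mulf_eq0; apply/orP; left; apply/eqP.
    rewrite big1// => u _; rewrite /F; case: forallP => [H|]; last by rewrite mulr0.
    have := H a; rewrite eqxx => /eqP ua; have := H a'; rewrite caa' eqxx => /eqP ua'.
    by move: c'aa'; rewrite -ua -ua' eqxx.
  wlog lt : a a' caa' c'aa' / (a' < a)%N.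
    move=> W; have [?|?|e] := ltngtP a' a; first exact: (W a a').
      by apply: (W a' a) => //; rewrite eq_sym.
    by move: c'aa'; rewrite (val_inj e) eqxx.
  rewrite /coal_step (bigD1 a)//= ifT; last first.
    by apply/existsP; exists a'; rewrite lt caa' eqxx.
  case: forallP => [/(_ a')|]; last by rewrite mul0r.
  by rewrite lt caa' eqxx (negbTE c'aa').
have ccE a a' : c a = c a' -> c' a = c' a'.
  by move=> e; have /forallP/(_ a)/forallP/(_ a') := cc'; rewrite e eqxx => /eqP.
transitivity (\prod_(a | leader a) P (c a) (c' a)).
  rewrite /coal_step [RHS]big_mkcond; apply: eq_bigr => a _; rewrite /leader if_neg.
  case: ifP => // _; case: forallP => // -[] b; apply/implyP => /andP[_ /eqP cb].
  by rewrite (ccE _ _ cb).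
have FE a : \sum_u F (r (c a)) u = P (c a) (c' a).
  rewrite (bigD1 (c' a))//= big1 ?addr0 => [|u ua].
    rewrite /F yr; case: forallP => [_|[]]; first by rewrite mulr1.
    move=> a'; apply/implyP => /eqP e; rewrite (ccE a a')//.
    by rewrite -yr -e yr.
  rewrite /F; case: forallP => [/(_ a)|_]; last by rewrite mulr0.
  by rewrite eqxx (negbTE ua).
transitivity (\prod_(b in [set r (c a) | a in leader]) \sum_u F b u).
  rewrite big_imset/=; first by apply: eq_bigr => a _; rewrite FE.
  have lt_leader a a' : leader a' -> c a = c a' -> (a < a')%N -> False.
    by move=> /negP la' e lt; apply: la'; apply/existsP; exists a; rewrite lt e eqxx.
  move=> a a'; rewrite !unfold_in => la la' /(congr1 (fun_of_fin y)); rewrite !yr => e.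
  have [lt|lt|/ord_inj//] := ltngtP a a'.
    by case: (lt_leader _ _ la' e lt).
  by case: (lt_leader _ _ la (esym e) lt).
(* A walker followed by nobody is unconstrained and sums to 1. *)
rewrite big_mkcond; apply: eq_bigr => b _; case: ifP => // bN.
rewrite -[LHS](P1 (y b)); apply: eq_bigr => u _; rewrite /F.
case: forallP => [_|[]]; first by rewrite mulr1.
move=> a; apply/implyP => /eqP e; have [a' la' ca'] := leaderP a.
by move/negP: bN; case; apply/imsetP; exists a'; rewrite // ca'.
Qed.

Lemma act_coal_step P c y (r : V -> 'I_n) F : stochastic P ->
  (forall a, y (r (c a)) = c a) ->
  act (coal_step P) F c = act (move P) (fun y' => F [ffun a => y' (r (c a))]) y.
Proof.
move=> P1 yr; rewrite /act.
under eq_bigr do rewrite (coal_step_move _ P1 yr) mulr_suml.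
rewrite exchange_big; apply: eq_bigr => y' _ /=.
rewrite (bigD1 [ffun a => y' (r (c a))])//= eqxx mulr1 big1 ?addr0// => c'.
by move=> /negbTE ->; rewrite mulr0 mul0r.
Qed.

Lemma coal_step_stochastic P : stochastic P -> stochastic (coal_step P).
Proof.
move=> P1; split => [c c'|c].
  by apply: prodr_ge0 => a _; case: ifP => // _; exact: P1.1.
have [r rP] : exists r : V -> 'I_n, forall a, c (r (c a)) = c a.
  have [a0|none] := pickP (fun _ : 'I_n => true).
    exists (fun v => odflt a0 [pick a | c a == v]) => a.
    by case: pickP => [b /eqP//|/(_ a)]; rewrite eqxx.
  have [v0|noV] := pickP (fun _ : V => true).
    by have := none (enum_rank v0).
  by exists (fun v => enum_rank v) => a; have := none a.
have := act_coal_step (fun=> 1) P1 rP; rewrite (act_cst _ _ (move_stochastic P1)).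
by move=> <-; apply: eq_bigr => c' _; rewrite mulr1.
Qed.

(** Coordinates move independently, so the sum factorizes; [k <= a] keeps the pinned walker [a] out
    of the product. *)
Lemma sum_move P y (a : 'I_n) k v (G : V -> R) : stochastic P -> (k <= a)%N ->
  \sum_(y' : positions V | y' a == v) move P y y' * \prod_(b < n | (b < k)%N) G (y' b) =
  P (y a) v * \prod_(b < n | (b < k)%N) act P G (y b).
Proof.
move=> P1 ka.
pose F b u : R := (if b == a then (u == v)%:R else 1) * P (y b) u * (if (b < k)%N then G u else 1).
transitivity (\sum_(y' : positions V) \prod_b F b (y' b)).
  rewrite big_mkcond; apply: eq_bigr => y' _; rewrite !big_split/=.
  rewrite [X in X * _ * _](bigD1 a)//= eqxx [X in _ * X * _ * _]big1 ?mulr1 => [|b /negbTE -> //].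
  rewrite -big_mkcond -/(move P y y').
  by case: (y' a == v); rewrite /= ?mul0r ?mul1r.
rewrite -bigA_distr_bigA (bigD1 a)//=; congr (_ * _).
  rewrite (bigD1 v)//= big1 ?addr0.
    by rewrite /F !eqxx ltnNge ka mul1r mulr1.
  by move=> u /negbTE uv; rewrite /F eqxx uv !mul0r.
rewrite [RHS]big_mkcond [RHS](bigD1 a)//= ltnNge ka mul1r; apply: eq_bigr => b ba.
rewrite /F (negbTE ba); case: ifP => _; last first.
  by under eq_bigr do rewrite mulr1 mul1r; exact: P1.2.
by apply: eq_bigr => u _; rewrite mul1r.
Qed.

Variable Q : nat -> V -> V -> R.
Hypothesis stoQ : forall t, stochastic (Q t).

(* Among independent walkers, a meets no walker b < k at the m times from t
   on which satisfy W. *)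
Fixpoint unmet (W : pred nat) k (a : 'I_n) m t y : R :=
  if m is m'.+1 then
    (~~ (W t && [exists b : 'I_n, (b < k)%N && (y b == y a)]))%:R *
    act (move (Q t)) (unmet W k a m' t.+1) y
  else 1.

(** Given the trajectory of [a], the walkers [b < k] are independent, and [a] is not one of them. *)
Lemma unmetE W k (a : 'I_n) m t y : (k <= a)%N ->
  unmet W k a m t y =
  path_mean Q m t (y a) (fun h => \prod_(b < n | (b < k)%N) miss Q W t h (y b)).
Proof.
move=> ka; elim: m t y => [|m IH] t y; first by rewrite /= big1.
rewrite /=; set D := (~~ _)%:R.
have DE : D = \prod_(b < n | (b < k)%N) (~~ (W t && (y b == y a)))%:R.
  rewrite prod_indicator; congr (nat_of_bool _)%:R.
  case: (W t) => /=; last by apply/esym/forallP => b; rewrite implybT.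
  rewrite negb_exists; apply: eq_forallb => b.
  by rewrite negb_and implybE.
have -> : act (Q t) (fun v' => path_mean Q m t.+1 v' (fun h =>
     \prod_(b < n | (b < k)%N)
       ((~~ (W t && (y b == y a)))%:R * act (Q t) (miss Q W t.+1 h) (y b)))) (y a) =
   D * act (Q t) (fun v' => path_mean Q m t.+1 v' (fun h =>
     \prod_(b < n | (b < k)%N) act (Q t) (miss Q W t.+1 h) (y b))) (y a).
  rewrite /act mulr_sumr; apply: eq_bigr => v _; rewrite [RHS]mulrCA; congr (_ * _).
  by rewrite -path_mean_scale; apply: eq_path_mean => h; rewrite big_split/= -DE.
congr (_ * _).
transitivity (\sum_v \sum_(y' : positions V | y' a == v) move (Q t) y y' *
   path_mean Q m t.+1 v (fun h => \prod_(b < n | (b < k)%N) miss Q W t.+1 h (y' b))).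
  rewrite /act (partition_big (fun y' : positions V => y' a) predT)//=.
  by apply: eq_bigr => v _; apply: eq_bigr => y' /eqP <-; rewrite IH.
apply: eq_bigr => v _; rewrite -path_mean_scale.
rewrite big_mkcond/=.
transitivity (\sum_(y' : positions V) path_mean Q m t.+1 v (fun h =>
   (if y' a == v then move (Q t) y y' else 0) *
     \prod_(b < n | (b < k)%N) miss Q W t.+1 h (y' b))).
  by apply: eq_bigr => y' _; rewrite path_mean_scale; case: ifP; rewrite ?mul0r.
rewrite -path_mean_sum; apply: eq_path_mean => h.
rewrite -sum_move// [RHS]big_mkcond; apply: eq_bigr => y' _.
by case: ifP; rewrite ?mul0r.
Qed.

Variables (W : 'I_n -> pred nat) (k : 'I_n -> nat).
(* A walker which may be killed is no longer needed as a killer. *)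
Hypothesis W_order : forall a a' t t', W a t -> (a < k a')%N -> (t <= t')%N -> ~~ W a' t'.

(* [al] is the set of surviving walkers, a walker a being killed when it meets
   some b < k a at a time in W a; the killers are themselves still alive, so the
   coalescing walks always occupy a subset of the surviving positions. *)
Lemma coalescence_domination m t c y (al : {set 'I_n}) : (0 < n)%N ->
  (forall a, exists2 b, b \in al & y b = c a) ->
  (forall b a t', b \notin al -> (t <= t')%N -> (b < k a)%N -> ~~ W a t') ->
  avoid_from (fun t => coal_step (Q t)) (@coalesced V) m t c <=
  \sum_(a in al | (0 < a)%N) unmet (W a) (k a) a m t y.
Proof.
move=> n0; elim: m t c y al => [|m IH] t c y al cy alW.
  rewrite /= mulr1; have [_|nco] := boolP (coalesced c).
    by rewrite sumr_ge0.
  have [[a aal a0]|none] := pselect (exists2 a : 'I_n, a \in al & (0 < a)%N).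
    by rewrite (bigD1 a) ?aal//= lerDl sumr_ge0.
  (* If no positive index survives, every walk stands where walker 0 does. *)
  exfalso; move/negP: nco; apply.
  have yc a : c a = y (Ordinal n0).
    have [b bal <-] := cy a; congr (y _); apply/val_inj/eqP => /=.
    by rewrite -leqn0 leqNgt; apply/negP => b0; apply: none; exists b.
  rewrite /coalesced (@eq_card _ _ (pred1 (y (Ordinal n0)))) ?card1// => v.
  rewrite [RHS]inE; apply/codomP/eqP => [[a ->]//|->].
  by exists (Ordinal n0).
pose killed a := W a t && [exists b : 'I_n, (b < k a)%N && (y b == y a)].
pose al' := [set a in al | ~~ killed a].
(* A walker killed now leaves its killer [d] on the same vertex: [d] is alive by [alW] and is not
   killed now by [W_order]. *)
have cy' a : exists2 b, b \in al' & y b = c a.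
  have [b bal yb] := cy a; have [kb|nkb] := boolP (killed b); last first.
    by exists b => //; rewrite inE bal.
  have /andP[Wb /existsP[d /andP[dk /eqP yd]]] := kb.
  exists d; last by rewrite yd.
  rewrite inE; apply/andP; split.
    apply/negPn/negP => dal; have := alW d b t dal (leqnn t) dk.
    by rewrite Wb.
  apply/negP => /andP[Wd _]; have := W_order Wd dk (leqnn t).
  by rewrite Wb.
pose r v := odflt (Ordinal n0) [pick a in al' | y a == v].
have rP a : r (c a) \in al' /\ y (r (c a)) = c a.
  rewrite /r; case: pickP => [b /andP[bal /eqP]//|none].
  by have [b bal yb] := cy' a; have := none b; rewrite bal yb eqxx.
rewrite [avoid_from _ _ _ _ _]/=.
apply: (@le_trans _ _ (act (coal_step (Q t))
   (avoid_from (fun t => coal_step (Q t)) (@coalesced V) m t.+1) c)).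
  rewrite ler_piMl ?lern1 ?leq_b1// act_ge0//; first exact: coal_step_stochastic.
  move=> c'; apply: avoid_from_ge0 => t'; exact: coal_step_stochastic.
rewrite (act_coal_step _ (stoQ t) (fun a => (rP a).2)).
have moveQ := move_stochastic (stoQ t).
apply: (@le_trans _ _ (act (move (Q t)) (fun y' =>
   \sum_(a in al' | (0 < a)%N) unmet (W a) (k a) a m t.+1 y') y)).
  apply: act_le => // y'; apply: IH => [a|b a t' bal tt' bk].
    by exists (r (c a)); rewrite ?ffunE//; exact: (rP a).1.
  move: bal; rewrite inE negb_and negbK => /orP[bal|/andP[Wb _]].
    exact: alW bal (ltnW tt') bk.
  exact: W_order Wb bk (ltnW tt').
rewrite /act; under eq_bigr do rewrite mulr_sumr.
(* Returning from [al'] to [al] costs nothing: [unmet] is 0 for the walkers killed at this step. *)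
rewrite exchange_big/= big_mkcond [leRHS]big_mkcond; apply: ler_sum => a _ /=.
rewrite inE; case: (a \in al) => //=.
case: (0 < a)%N; rewrite ?andbF// andbT /killed.
by case: (_ && _); rewrite /= ?mul0r ?mul1r.
Qed.

End coupling.

(** * Epochs and estimates *)

Section estimates.
Context (R : realType).

(** Bernoulli: [(1 - x)^k * (1 + k * x) <= 1], taken at [k * x = 1]. *)
Lemma geometric_half (N : nat) : (0 < N)%N -> (1 - N%:R^-1 : R) ^+ N <= 1 / 2.
Proof.
move=> N0; have Np : 0 < N%:R :> R by rewrite ltr0n.
have N1 : N%:R^-1 <= 1 :> R by rewrite invf_le1// ler1n.
set x := N%:R^-1 in N1 *; have x0 : 0 < x by rewrite invr_gt0.
have key k : (1 - x) ^+ k * (1 + k%:R * x) <= 1.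
  elim: k => [|k IH]; first by rewrite expr0 mul0r; lra.
  apply: le_trans IH; rewrite exprSr -mulrA ler_wpM2l ?exprn_ge0 ?subr_ge0//.
  rewrite -natr1 -subr_ge0.
  have -> : 1 + k%:R * x - (1 - x) * (1 + (k%:R + 1) * x) = (k%:R + 1) * x ^+ 2 by ring.
  by rewrite mulr_ge0 ?addr_ge0 ?sqr_ge0.
by have := key N; rewrite mulfV ?gt_eqF//; lra.
Qed.

(** For [k] killers, each missed with probability [q] once mixed. At [q = 1/64] the mixture equals
    [1/8], the square root of [q]; below, it is at most [1/8], and above, at most the square root of
    [q]. *)
Lemma mixture_power (q : R) (k j : nat) : 0 <= q <= 1 ->
  q ^+ k <= (1 / 64) ^+ j -> (j <= k)%N -> (1 / 9 + (1 - 1 / 9) * q) ^+ k <= (1 / 8) ^+ j.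
Proof.
move=> /andP[q0 q1] qk jk.
have r0 : 0 <= 1 / 9 + (1 - 1 / 9) * q by lra.
have [q64|q64] := lerP q (1 / 64).
  apply: (@le_trans _ _ ((1 / 8) ^+ k)).
    have r8 : 1 / 9 + (1 - 1 / 9) * q <= 1 / 8 by lra.
    by apply: lerXn2r; rewrite ?nnegrE//; lra.
  by apply: ler_wiXn2l => //; lra.
have p8 : 0 <= 1 / 8 :> R by lra.
rewrite -(@ler_pXn2r _ 2)// ?nnegrE ?exprn_ge0//.
rewrite -!exprM [(k * 2)%N]mulnC [(j * 2)%N]mulnC !exprM.
have -> : (1 / 8) ^+ 2 = 1 / 64 :> R by field.
apply: le_trans qk; apply: lerXn2r; rewrite ?nnegrE ?sqr_ge0//.
rewrite -subr_ge0.
have -> : q - (1 / 9 + (1 - 1 / 9) * q) ^+ 2 = (64 / 81) * ((q - 1 / 64) * (1 - q)) by field.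
by rewrite !mulr_ge0//; lra.
Qed.

(** The left side is at most [(a + 1)^-3], which is below the telescoping term. *)
Lemma cube_telescope (a j : nat) : (0 < a)%N -> (a < 2 ^ j)%N ->
  (1 / 8) ^+ j <= 1 / 2 * (a%:R^-1 - a.+1%:R^-1) :> R.
Proof.
move=> a0 aj; have ap : 1 <= a%:R :> R by rewrite ler1n.
have -> : 1 / 8 = (2^-1) ^+ 3 :> R by field.
rewrite -exprM mulnC exprM exprVn.
have u : a.+1%:R <= 2 ^+ j :> R by rewrite -natrX ler_nat.
rewrite -natr1 in u *; set x := a%:R in ap u *.
have h : ((2 ^+ j)^-1) ^+ 3 <= ((x + 1)^-1) ^+ 3.
  by apply: lerXn2r; rewrite ?nnegrE ?invr_ge0 ?exprn_ge0 ?lef_pV2 ?posrE ?exprn_gt0//; lra.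
apply: (le_trans h); rewrite -subr_ge0.
have -> : 1 / 2 * (x^-1 - (x + 1)^-1) - (x + 1)^-1 ^+ 3 =
   (x ^+ 2 + 1) / (2 * x * (x + 1) ^+ 3) by field; lra.
rewrite divr_ge0 ?mulr_ge0 ?exprn_ge0 ?addr_ge0 ?sqr_ge0//; lra.
Qed.

Lemma sum_cube_telescope (n : nat) :
  \sum_(a < n | (0 < a)%N) (1 / 8) ^+ (trunc_log 2 a).+1 <= 1 / 2 :> R.
Proof.
case: n => [|n]; first by rewrite big_ord0; lra.
apply: (@le_trans _ _ (1 / 2 * (1 - n.+1%:R^-1))); last first.
  have : 0 < n.+1%:R^-1 :> R by rewrite invr_gt0 ltr0Sn.
  by move: (n.+1%:R^-1) => x; lra.
elim: n => [|n IH].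
  by rewrite big_mkcond big_ord_recr big_ord0/= add0r invr1; lra.
rewrite big_mkcond big_ord_recr -big_mkcond/=.
have := @cube_telescope n.+1 (trunc_log 2 n.+1).+1 isT (@trunc_log_ltn 2 _ isT).
move: (n.+1%:R^-1) (n.+2%:R^-1) IH => x y; lra.
Qed.

End estimates.

(** * Schedule of the epochs and total running time *)

Section schedule.
Variables (N n : nat).
Hypotheses (n2 : (2 <= n)%N) (nN : (n <= N)%N).

(** The [2 ^ j] killers of epoch [j] act in parallel, hence the division. Of the two extra steps,
    one offsets rounding down and one the time of a window that yields no factor [lam]. *)
Definition epoch_length j := ((6 * N * j.+1) %/ 2 ^ j).+2.
Definition mixing_length := ((6 * N).+1 + (6 * N).+1)%N.
(* Epoch j follows the epochs n-1, ..., j+1. *)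
Definition epoch_start j := (mixing_length + \sum_(j.+1 <= i < n) epoch_length i)%N.
Definition horizon := (mixing_length + \sum_(0 <= i < n) epoch_length i)%N.

Lemma epoch_lengthP j : (6 * N * j.+1 <= (epoch_length j).-1 * 2 ^ j)%N.
Proof. by apply: ltnW; rewrite /epoch_length /= -ltn_divLR// expn_gt0. Qed.

Lemma epoch_start_lt i j : (i < j)%N -> (j < n)%N ->
  (epoch_start j + epoch_length j <= epoch_start i)%N.
Proof.
move=> ij jn; rewrite /epoch_start -addnA leq_add2l addnC.
rewrite [leqRHS](big_cat_nat (n := j))//=; last exact: ltnW.
by rewrite [X in (_ <= _ + X)%N]big_ltn// leq_addl.
Qed.

Lemma epoch_end j : (j < n)%N -> (epoch_start j + epoch_length j <= horizon)%N.
Proof.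
move=> jn; rewrite /epoch_start /horizon -addnA leq_add2l addnC.
rewrite [leqRHS](big_cat_nat (n := j))//=; last exact: ltnW.
by rewrite [X in (_ <= _ + X)%N]big_ltn// leq_addl.
Qed.

(** Mixing takes [12 N + 2] steps, the epochs at most [24 N] since the sum of [(i + 1) / 2^i] is at
    most 4, their extra steps [2 n <= 2 N]; finally [2 <= N]. *)
Lemma horizon_le : (horizon <= 39 * N)%N.
Proof.
have sumE m : (\sum_(0 <= i < m) i.+1 * 2 ^ (m - i) + 2 * m + 4 = 2 ^ (m + 2))%N.
  elim: m => [|m IH]; first by rewrite big_geq.
  rewrite big_nat_recr//= subSn// subnn.
  have -> : (\sum_(0 <= i < m) i.+1 * 2 ^ (m.+1 - i) = 2 * \sum_(0 <= i < m) i.+1 * 2 ^ (m - i))%N.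
    rewrite big_distrr/=; apply: eq_big_nat => i /andP[_ im].
    by rewrite subSn ?(ltnW im)// expnS mulnCA.
  by rewrite addSn [(2 ^ (m + 2).+1)%N]expnS -IH expn1; lia.
have sumD : (\sum_(0 <= i < n) (6 * N * i.+1) %/ 2 ^ i <= 24 * N)%N.
  rewrite -(@leq_pmul2r (2 ^ n)) ?expn_gt0//.
  apply: (@leq_trans (6 * N * \sum_(0 <= i < n) i.+1 * 2 ^ (n - i))).
    rewrite big_distrl big_distrr/= big_nat [leqRHS]big_nat; apply: leq_sum => i /andP[_ im].
    rewrite -[in leqLHS](subnKC (ltnW im)) expnD mulnA [leqRHS]mulnA leq_mul2r.
    by rewrite leq_trunc_div orbT.
  have := sumE n; rewrite expnD; set s := (\sum_(0 <= i < n) _)%N.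
  move=> E; have sle : (s <= 4 * 2 ^ n)%N by lia.
  apply: leq_trans (leq_mul (leqnn (6 * N)%N) sle) _.
  by rewrite mulnA leq_mul2r; apply/orP; right; lia.
rewrite /horizon /mixing_length /epoch_length.
have -> : (\sum_(0 <= i < n) ((6 * N * i.+1) %/ 2 ^ i).+2 =
   \sum_(0 <= i < n) (6 * N * i.+1) %/ 2 ^ i + 2 * n)%N.
  under eq_bigr do rewrite -addn2.
  by rewrite big_split/=; congr addn; rewrite sum_nat_const_nat subn0 mulnC.
lia.
Qed.

End schedule.

(** * Coalescence within the horizon with probability at least one half *)

Section half.
Context (R : realType) (V : finType) (pi : V -> R) (N : nat).
Local Notation n := #|V|.
Local Notation lam := (1 - N%:R^-1 : R).
Hypotheses (pip : forall v, 0 < pi v) (pi1 : \sum_v pi v = 1).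
Hypotheses (n2 : (2 <= n)%N) (nN : (n <= N)%N).

Definition killing_window (a : 'I_n) : pred nat := fun t =>
  let j := trunc_log 2 a in
  [&& (0 < a)%N, (epoch_start N n j <= t)%N & (t < epoch_start N n j + epoch_length N j)%N].

Definition killers (a : 'I_n) : nat := if (0 < a)%N then (2 ^ trunc_log 2 a)%N else 0%N.

Lemma killers_le a : (killers a <= a)%N.
Proof. by rewrite /killers; case: ifP => // a0; exact: trunc_logP. Qed.

Lemma epoch_lt_card (a : 'I_n) : (0 < a)%N -> (trunc_log 2 a < n)%N.
Proof.
move=> a0; apply: leq_ltn_trans (ltn_ord a); apply: leq_trans (trunc_logP (isT : (1 < 2)%N) a0).
exact/ltnW/ltn_expl.
Qed.

(** A killer of [a'] lies in a lower dyadic block, whose epoch comes after that of [a']. *)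
Lemma killing_window_order a a' t t' : killing_window a t -> (a < killers a')%N ->
  (t <= t')%N -> ~~ killing_window a' t'.
Proof.
rewrite /killing_window /killers => /and3P[a0 st _]; case: ifP => // a'0 aa' tt'.
apply/negP => /and3P[_ _ t'e].
have jj : (trunc_log 2 a < trunc_log 2 a')%N.
  rewrite -(@ltn_exp2l 2)//; apply: leq_ltn_trans aa'; exact: trunc_logP.
have := @epoch_start_lt N n _ _ jj (epoch_lt_card a'0).
lia.
Qed.

Lemma lam_gt0 : 0 < lam.
Proof. by rewrite subr_gt0 invf_lt1 ?ltr1n ?ltr0n//; lia. Qed.

Lemma lam_6N : lam ^+ (6 * N) <= 1 / 64.
Proof.
rewrite mulnC exprM; have -> : 1 / 64 = (1 / 2) ^+ 6 :> R by field.
have l0 := ltW lam_gt0.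
have h0 : 0 <= 1 / 2 :> R by lra.
apply: lerXn2r; rewrite ?nnegrE ?exprn_ge0//.
by apply: geometric_half; lia.
Qed.

(** Each of the [2 ^ j] independent killers is missed with probability at most [1/9 + 8/9 * lam^d],
    and the epoch length brings [lam^(d * 2^j)] down to [64^-(j + 1)]. *)
Lemma unmet_le (Q : nat -> V -> V -> R) (a : 'I_n) y :
  (forall t, admissible pi lam (Q t)) -> (0 < a)%N ->
  unmet Q (killing_window a) (killers a) a (horizon N n) 0 y <= (1 / 8) ^+ (trunc_log 2 a).+1.
Proof.
move=> adQ a0; have stoQ t' : stochastic (Q t') by have [] := adQ t'.
have l0 := ltW lam_gt0.
have l1 : lam <= 1 by rewrite gerBl.
rewrite unmetE ?killers_le//; apply: path_mean_le => // h hL.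
set j := trunc_log 2 a; set d := (epoch_length N j).-1.
have dE : epoch_length N j = d.+1 by [].
have jn := epoch_lt_card a0.
have kE : killers a = (2 ^ j)%N by rewrite /killers a0.
apply: (@le_trans _ _ (\prod_(b < n | (b < 2 ^ j)%N) (1 / 9 + (1 - 1 / 9) * lam ^+ d))).
  rewrite kE; apply: ler_prod => b _; rewrite miss_ge0//=.
  apply: (@miss_after_mixing _ _ pi lam pip pi1 lam_gt0 Q _ (6 * N) (epoch_start N n j)) => //.
  - exact: leq_addr.
  - by move=> t tj; rewrite /killing_window -/j [(_ <= t)%N]leqNgt tj andbF.
  - by move=> i id; rewrite /killing_window -/j a0 leq_addr dE ltn_add2l ltnS.
  - by rewrite hL; apply: leq_trans (epoch_end N jn); rewrite dE addnS.
  (* The mixing error is at most [4 / 64], which is below [1 / 9]. *)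
  - by have := lam_6N; lra.
  - by lra.
have kn : (2 ^ j <= n)%N.
  by apply: ltnW; apply: leq_ltn_trans (ltn_ord a); exact: trunc_logP.
rewrite -(big_ord_widen n (fun=> 1 / 9 + (1 - 1 / 9) * lam ^+ d) kn) prodr_const card_ord.
apply: mixture_power; last exact: ltn_expl.
  by rewrite exprn_ge0// exprn_ile1.
rewrite -exprM; apply: (@le_trans _ _ (lam ^+ (6 * N * j.+1))).
  by apply: ler_wiXn2l => //; exact: epoch_lengthP.
have h0 : 0 <= 1 / 64 :> R by lra.
by rewrite exprM; apply: lerXn2r; rewrite ?nnegrE ?exprn_ge0// lam_6N.
Qed.

Lemma avoid_from_shift (S : finType) (K : nat -> S -> S -> R) (A : pred S) m t x :
  avoid_from K A m t x = avoid_from (fun i => K (t + i)%N) A m 0 x.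
Proof.
suff key s : avoid_from K A m (t + s) x = avoid_from (fun i => K (t + i)%N) A m s x.
  by rewrite -{1}(addn0 t) key.
elim: m s x => [//|m IH] s x /=; congr (_ * act _ _ x); apply/funext => y.
by rewrite -addnS IH.
Qed.

(** All walkers start alive, and the survival bounds are summed over the positive indices. Repeated
    trials require uniformity in [t] and [c]. *)
Lemma coalescence_half (Q : nat -> V -> V -> R) t c :
  (forall t, admissible pi lam (Q t)) ->
  avoid_from (fun t => coal_step (Q t)) (@coalesced V) (horizon N n) t c <= 1 / 2.
Proof.
move=> adQ; rewrite avoid_from_shift.
have stoQ i : stochastic (Q (t + i)%N) by have [] := adQ (t + i)%N.
have alive a : exists2 b : 'I_n, b \in [set: 'I_n] & c b = c a by exists a; rewrite // inE.
have dead (b a : 'I_n) t' : b \notin [set: 'I_n] -> (0 <= t')%N -> (b < killers a)%N ->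
  ~~ killing_window a t' by rewrite inE.
have := coalescence_domination stoQ killing_window_order (horizon N n)
  (ltnW n2) alive dead.
move=> /le_trans; apply.
apply: le_trans (sum_cube_telescope R n).
rewrite (eq_bigl (fun a : 'I_n => 0 < a)%N); last by move=> a; rewrite inE.
by apply: ler_sum => a a0; apply: unmet_le => // i; exact: adQ.
Qed.

End half.

(** * Expected hitting times and partial sums of avoidance probabilities *)

Section expectations.
Context (R : realType) (S : finType).
Implicit Types (K : nat -> S -> S -> R) (A : pred S).

Lemma avoid_prob_ge0 K x A m : (forall t, stochastic (K t.+1)) -> 0 <= avoid_prob K x A m.
Proof. by move=> K1; rewrite avoid_probE; exact: avoid_from_ge0. Qed.

Lemma expected_hit_time_le K x A (c : R) : (forall t, stochastic (K t.+1)) ->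
  (forall M, \sum_(m < M) avoid_from (fun t => K t.+1) A m 0 x <= c) ->
  (expected_hit_time K x A <= c%:E)%E.
Proof.
move=> K1 Kc; apply: ge_ereal_sup => _ [d [T [Pr [X [mcX ->]]]]].
rewrite (integral_hit_time mcX); apply: lime_le.
  by apply: is_cvg_nneseries => m _ _; rewrite lee_fin avoid_prob_ge0.
apply: nearW => M; rewrite big_mkord sumEFin lee_fin; apply: le_trans (Kc M).
by apply: ler_sum => m _; rewrite avoid_probE.
Qed.

(** The expectation is a supremum over realizations, so a lower bound needs the existence of one. *)
Lemma expected_hit_time_ge K x A M : (forall t, stochastic (K t.+1)) ->
  ((\sum_(m < M) avoid_from (fun t => K t.+1) A m 0 x)%:E <= expected_hit_time K x A)%E.
Proof.
move=> K1.
have [||d [T [Pr [X mcX]]]] := @markov_chain_exists R S K x.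
- by move=> [//|t] s s' _; exact: (K1 t).1.
- by move=> [//|t] s _; exact: (K1 t).2.
rewrite (expected_hit_timeE A mcX) (integral_hit_time mcX).
apply: le_trans (nneseries_lim_ge (m := 0) M _); last first.
  by move=> m _ _; rewrite lee_fin avoid_prob_ge0.
rewrite big_mkord sumEFin lee_fin; apply: ler_sum => m _.
by rewrite avoid_probE.
Qed.

End expectations.

Theorem theorem1p6 (R : realType) :
  exists C : R, 0 < C /\
    forall (V : finType) (P : nat -> V -> V -> R) (pi : V -> R),
      (2 <= #|V|)%N ->
      (forall t : nat, (1 <= t)%N ->
         [/\ transition_matrix (P t), irreducible (P t), reversible (P t) pi,
             lazy (P t) & stationary_distribution (P t) pi]) ->
      (t_HIT P < +oo)%E ->
      (t_coal P <= C%:E * t_HIT P)%E.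
Proof.
(* [156 = 2 * 39 * 2]: repeated trials, the horizon [39 N], and [N <= 2 t_HIT]. *)
exists 156; split=> // V P pi n2 HP Hfin.
have stoP t : stochastic (P t.+1).
  by have [[P01 P1] _ _ _ _] := HP t.+1 isT; split => // u v; have /andP[] := P01 u v.
have [_ _ _ _ [pi0 pi1 _]] := HP 1%N isT.
have hitP t u w M : ((\sum_(m < M) stay (P t.+1) w m u)%:E <= t_HIT P)%E.
  have stayE m s x : avoid_from (fun=> P t.+1) (pred1 w) m s x = stay (P t.+1) w m x.
    elim: m s x => [//|m IH] s x /=; congr (_ * act _ _ x); apply/funext => y; exact: IH.
  apply: (@le_trans _ _ (t_hit (P t.+1))); last first.
    by apply: ereal_sup_ubound; exists t.+1.
  apply: le_trans (le_bigmax _ _ u); apply: le_trans (le_bigmax _ _ w).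
  apply: le_trans (@expected_hit_time_ge _ _ (fun=> P t.+1) u (pred1 w) M _); last by move=> s.
  by rewrite lee_fin; apply: ler_sum => m _; rewrite stayE.
have [w [u uw]] : exists w u : V, u != w.
  have /card_gt1P[u [w [_ _ uw]]] : (1 < #|V|)%N by [].
  by exists w, u.
(* Reaching [w] from [u] takes at least one step; this also excludes the value [-oo] and gives
   [N <= 2 H]. *)
have : (1%:E <= t_HIT P)%E.
  by apply: le_trans (hitP 0%N u w 1%N); rewrite big_ord_recr big_ord0 /= uw mulr1 add0r.
case: (t_HIT P) Hfin hitP => [H|//|//] _ hitP; rewrite lee_fin => H1.
pose N := (Num.truncn H).+1.
have HN : H <= N%:R by exact/ltW/truncnS_gt.
have NH : N%:R <= 2 * H.
  rewrite /N -natr1; have : (Num.truncn H)%:R <= H by rewrite truncn_le//; lra.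
  lra.
have N1 : 1 <= N%:R :> R by rewrite ler1n.
have adP t : admissible pi (1 - N%:R^-1) (P t.+1).
  have [_ _ revP lazyP _] := HP t.+1 isT; split => //.
  apply: hitting_contraction => // w' u' M.
  by apply: le_trans HN; have := hitP t u' w' M; rewrite lee_fin.
have mass v : 2 * (1 - pi v) <= N%:R * pi v.
  have [? ? ? cM] := adP 0%N.
  by apply: killed_contraction_mass cM => //; lra.
have pip v : 0 < pi v.
  rewrite lt_neqAle pi0 andbT eq_sym; apply/eqP => piv.
  by have := mass v; rewrite piv; lra.
(* Summing [mass] over the vertices gives [2 (n - 1) <= N], and [n >= 2]. *)
have nN : (#|V| <= N)%N.
  have : 2 * (#|V|%:R - 1) <= N%:R :> R.
    have : \sum_v 2 * (1 - pi v) <= \sum_v N%:R * pi v by apply: ler_sum => v _.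
    by rewrite -!mulr_sumr sumrB pi1 sumr_const mulr1.
  have : 2 <= #|V|%:R :> R by rewrite ler_nat.
  by rewrite -(ler_nat R); lra.
rewrite -EFinM; apply: bigmax_le => [|x _]; first exact: leNye.
apply: expected_hit_time_le => [t|M]; first exact: coal_step_stochastic.
apply: le_trans (@sum_avoid_from _ _ (fun t => coal_step (P t.+1)) _ _ (horizon N #|V|) 0 x _ M) _.
- by move=> t; exact: coal_step_stochastic.
- move=> t c; exact: (@coalescence_half _ _ pi N pip pi1 n2 nN (fun t => P t.+1)).
have := horizon_le n2 nN; rewrite -(ler_nat R) natrM; lra.
Qed.
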